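(* Let $\Gamma$ be an infinite group of type $\mathrm{FP}_2$ and let $\alpha$ be a standard action of $\Gamma$. Then $$\mathrm{medim}^{\mathbb{Z}}_1(\alpha)\le\mathrm{cost}(\alpha)-1.$$
   Context: A group $\Gamma$ is of type $\mathrm{FP}_m$ if the trivial $\mathbb{Z}\Gamma$-module $\mathbb{Z}$ has a projective resolution that is finitely generated in degrees $\le m$. A standard $\Gamma$-action $\alpha\colon\Gamma\curvearrowright(X,\mu)$ is an essentially free, probability measure preserving action of a countable group on a standard Borel probability space. Let $\mathcal{R}_\alpha=\{(x,\gamma\cdot x)\mid x\in X,\gamma\in\Gamma\}$ be its orbit relation. A graphing of $\mathcal{R}_\alpha$ is a countable family $\Phi=(\varphi_i\colon A_i\to B_i)_{i}$ of measurable isomorphisms between measurable subsets of $X$ with $(x,\varphi_i(x))\in\mathcal{R}_\alpha$ for all $x\in A_i$, which generates $\mathcal{R}_\alpha$ as an equivalence relation (up to null sets); $\mathrm{cost}(\Phi)=\sum_i\mu(A_i)$, and $\mathrm{cost}(\alpha)$ is the infimum of $\mathrm{cost}(\Phi)$ over all graphings $\Phi$ of $\mathcal{R}_\alpha$. $L^\infty(\alpha,\mathbb{Z})=L^\infty(X,\mu,\mathbb{Z})$ is the ring of essentially bounded measurable functions $X\to \mathbb{Z}$ modulo a.e. equality, with $(\gamma\cdot\lambda)(x)=\lambda(\gamma^{-1}x)$. The crossed product ring $R=L^\infty(\alpha,\mathbb{Z})*\Gamma$ is the free $L^\infty(\alpha,\mathbb{Z})$-module with basis $\Gamma$ (elements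 are finite sums of terms $(\lambda,\gamma)$) with multiplication $(\lambda,\gamma)(\lambda',\gamma')=(\lambda\cdot(\gamma\cdot\lambda'),\gamma\gamma')$. It contains $\mathbb{Z}\Gamma$ via $\gamma\mapsto(1,\gamma)$ and acts on $L^\infty(\alpha,\mathbb{Z})$ by $(\lambda,\gamma)\cdot f=\lambda\cdot(\gamma\cdot f)$. For measurable $A\subset X$ put $\langle A\rangle=R\cdot(\chi_A,1)$. A marked projective $R$-module is an $R$-module $M$ with a finite family $(A_i)_{i\in I}$ of measurable subsets of $X$ and an isomorphism $M\cong\bigoplus_{i\in I}\langle A_i\rangle$; $\dim_R(M)=\sum_i\mu(A_i)$. A marked projective augmented $R$-chain complex $D_*\twoheadrightarrow L^\infty(\alpha,\mathbb{Z})$ is a chain complex $(D_k)_{k\ge0}$ of marked projective $R$-modules with a surjective $R$-homomorphism $\eta\colon D_0\to L^\infty(\alpha,\mathbb{Z})$, $\eta\circ\partial_1=0$. Fix a free $\mathbb{Z}\Gamma$-resolution $C_*\twoheadrightarrow \mathbb{Z}$ (the following is independent of the choice). An $\alpha$-embedding (up to degree $n$) is such a complex together with a $\mathbb{Z}\Gamma$-chain map $C_*\to D_*$ up to degree $n+1$ extending the inclusion $\mathbb{Z}\to L^\infty(\alpha,\mathbb{Z})$ as constant functions. $A_n(\alpha)$ is the class of all augmented complexes $D_*$ arising in this way, and $\mathrm{medim}^{\mathbb{Z}}_n(\alpha)=\inf_{D_*\in A_n(\alpha)}\dim_R(D_n)$ (here used with $n=1$). *)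

(* Defs.v *)
From HB Require Import structures.
From mathcomp Require Import all_boot all_order all_algebra.
From mathcomp Require Import finmap.
From mathcomp Require Import all_classical all_reals all_analysis.
From Stdlib Require Import Relation_Operators.
Set Implicit Arguments.
Unset Strict Implicit.
Unset Printing Implicit Defensive.
Import Order.TTheory GRing.Theory Num.Theory.
Local Open Scope classical_set_scope.
Local Open Scope ring_scope.

Section FinSuppExt.
Local Open Scope fset_scope.
Local Open Scope ring_scope.
Variables (G : choiceType) (A : nzRingType).
Implicit Types f h : {fsfun G -> A with 0}.

Definition fs_single (g : G) (a : A) : {fsfun G -> A with 0} :=
  [fsfun x in [fset g] => a].
Definition fs_add f h : {fsfun G -> A with 0} :=
  [fsfun x in finsupp f `|` finsupp h => f x + h x].
Definition fs_opp f : {fsfun G -> A with 0} := [fsfun x in finsupp f => - f x].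

Lemma fs_singleE g a x : fs_single g a x = if x == g then a else 0.
Proof. by rewrite fsfunE inE. Qed.

Lemma fs_addE f h x : fs_add f h x = f x + h x.
Proof.
rewrite fsfunE inE !mem_finsupp.
by case: eqP => [->|//]; case: eqP => [->|//]; rewrite addr0.
Qed.

Lemma fs_oppE f x : fs_opp f x = - f x.
Proof. by rewrite fsfunE mem_finsupp; case: eqP => [->|//]; rewrite oppr0. Qed.

End FinSuppExt.

Record ring_action (G : groupType) (A : comNzRingType) := RingAction {
  ract :> G -> {rmorphism A -> A};
  ract1 : forall a, ract 1%g a = a;
  ractM : forall g h a, ract (g * h)%g a = ract g (ract h a)
}.

(* The crossed product A * G: finitely supported G -> A, where [single g a]
   stands for the basis term (a, g).  The group ring Z[G] is the case A = int
   with the trivial action. *)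
Record crossed (G : groupType) (A : comNzRingType) (rho : ring_action G A) :=
  Crossed { crossed_coef :> {fsfun G -> A with 0} }.

Section Crossed.
Local Open Scope fset_scope.
Local Open Scope ring_scope.
Variables (G : groupType) (A : comNzRingType) (rho : ring_action G A).
Local Notation R := (crossed rho).
Implicit Types (f h r : R) (g k : G) (a b : A).

HB.instance Definition _ := [isNew for @crossed_coef G A rho].
HB.instance Definition _ := [Choice of R by <:].

Lemma crossedP f h : (forall x, f x = h x) -> f = h.
Proof. by move=> fh; apply/val_inj/fsfunP. Qed.

Definition crossed_add f h : R := Crossed rho (fs_add f h).
Definition crossed_opp f : R := Crossed rho (fs_opp f).
Definition crossed_zero : R := Crossed rho [fsfun].

Fact crossed_addA : associative crossed_add.
Proof. by move=> f h r; apply: crossedP => x; rewrite !fs_addE addrA. Qed.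
Fact crossed_addC : commutative crossed_add.
Proof. by move=> f h; apply: crossedP => x; rewrite !fs_addE addrC. Qed.
Fact crossed_add0 : left_id crossed_zero crossed_add.
Proof. by move=> f; apply: crossedP => x; rewrite fs_addE fsfunE add0r. Qed.
Fact crossed_addN : left_inverse crossed_zero crossed_opp crossed_add.
Proof.
by move=> f; apply: crossedP => x; rewrite fs_addE fs_oppE fsfunE addNr.
Qed.

HB.instance Definition _ := GRing.isZmodule.Build R
  crossed_addA crossed_addC crossed_add0 crossed_addN.

Definition single g a : R := Crossed rho (fs_single g a).

Lemma crossedD f h x : (f + h) x = f x + h x. Proof. exact: fs_addE. Qed.
Lemma crossedN f x : (- f) x = - f x. Proof. exact: fs_oppE. Qed.
Lemma crossed0 x : (0 : R) x = 0. Proof. exact: fsfun0E. Qed.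
Lemma singleE g a x : single g a x = if x == g then a else 0.
Proof. exact: fs_singleE. Qed.

Lemma crossed_sum I (s : seq I) (F : I -> R) x :
  (\sum_(i <- s) F i) x = \sum_(i <- s) F i x.
Proof.
elim: s => [|i s IH]; first by rewrite !big_nil crossed0.
by rewrite !big_cons crossedD IH.
Qed.

Lemma single_is_zmod_morphism g : zmod_morphism (single g).
Proof.
move=> a b; apply: crossedP => x.
by rewrite crossedD crossedN !singleE; case: eqP; rewrite ?subr0.
Qed.
HB.instance Definition _ g :=
  GRing.isZmodMorphism.Build A R (single g) (single_is_zmod_morphism g).

Section Ext.
Variables (V : zmodType) (F : G -> A -> V).
Definition crossed_ext (f : R) : V := \sum_(g <- finsupp f) F g (f g).
Hypothesis FB : forall g, zmod_morphism (F g).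

Let F0 g : F g 0 = 0. Proof. by rewrite -[X in F g X](subrr 0) FB subrr. Qed.

Lemma crossed_ext_incl (f : R) (S : {fset G}) :
  finsupp f `<=` S -> crossed_ext f = \sum_(g <- S) F g (f g).
Proof.
move=> sfS; apply: big_fset_incl => // x _ xf.
by rewrite fsfun_dflt.
Qed.

Lemma crossed_ext_is_zmod_morphism : zmod_morphism crossed_ext.
Proof.
move=> f h; pose S := finsupp f `|` finsupp h `|` finsupp (f - h).
have sS x : (x \in S) = [|| x \in finsupp f, x \in finsupp h
    | x \in finsupp (f - h)] by rewrite !in_fsetU orbA.
rewrite (@crossed_ext_incl f S); last first.
  by apply/fsubsetP => x xf; rewrite sS xf.
rewrite (@crossed_ext_incl h S); last first.
  by apply/fsubsetP => x xh; rewrite sS xh orbT.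
rewrite (@crossed_ext_incl _ S); last first.
  by apply/fsubsetP => x xh; rewrite sS xh !orbT.
by rewrite -sumrB; apply: eq_bigr => g _; rewrite crossedD crossedN FB.
Qed.

Lemma crossed_ext_single g a : crossed_ext (single g a) = F g a.
Proof.
rewrite (@crossed_ext_incl _ [fset g]); last first.
  apply/fsubsetP => x; rewrite mem_finsupp inE.
  by rewrite singleE; have [//|_] := eqVneq x g; rewrite eqxx.
by rewrite big_seq_fset1 singleE eqxx.
Qed.

End Ext.

Lemma crossed_decomp f : f = crossed_ext single f.
Proof.
apply: crossedP => x; rewrite crossed_sum.
under eq_bigr do rewrite singleE.
have [xf|xf] := boolP (x \in finsupp f).
  rewrite (big_fsetD1 x) //= eqxx big1_fset ?addr0 // => i.
  by rewrite !inE eq_sym => /andP[/negPf -> _].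
rewrite fsfun_dflt // big1_fset // => i fi _.
by case: eqP => // xi; move: xf; rewrite xi fi.
Qed.

Lemma crossed_ext_eq (V : zmodType) (p q : R -> V) :
  zmod_morphism p -> zmod_morphism q ->
  (forall g a, p (single g a) = q (single g a)) -> p =1 q.
Proof.
move=> pB qB pq f.
pose P : {additive R -> V} :=
  HB.pack p (GRing.isZmodMorphism.Build R V p pB).
pose Q : {additive R -> V} :=
  HB.pack q (GRing.isZmodMorphism.Build R V q qB).
rewrite -[p]/(P : R -> V) -[q]/(Q : R -> V) (crossed_decomp f) !raddf_sum.
by apply: eq_bigr => g _; apply: pq.
Qed.

(* The biadditive extension of (a, g) (b, k) = (a * (g . b), g k); see
   [single_mul] below. *)
Definition crossed_mul (f h : R) : R :=
  crossed_ext (fun g a =>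
    crossed_ext (fun k b => single (g * k)%g (a * rho g b)) h) f.

Let mul_inner g a : zmod_morphism (fun b => single g (a * b)).
Proof. by move=> b c; rewrite mulrBr raddfB. Qed.

Let mul_inner1 g a k : zmod_morphism (fun b => single (g * k)%g (a * rho g b)).
Proof. by move=> b c; rewrite raddfB mulrBr raddfB. Qed.

Let mul_inner2 h g :
  zmod_morphism (fun a => crossed_ext (fun k b => single (g * k)%g (a * rho g b)) h).
Proof.
move=> a b; rewrite -sumrB; apply: eq_bigr => k _.
by rewrite mulrBl raddfB.
Qed.

Lemma crossed_mulBl h : zmod_morphism (crossed_mul^~ h).
Proof. by apply: crossed_ext_is_zmod_morphism => g; apply: mul_inner2. Qed.

Lemma crossed_mulBr f : zmod_morphism (crossed_mul f).
Proof.
move=> h r; rewrite -sumrB; apply: eq_bigr => g _.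
by apply: crossed_ext_is_zmod_morphism => k; apply: mul_inner1.
Qed.

Lemma crossed_mul_single g a k b :
  crossed_mul (single g a) (single k b) = single (g * k)%g (a * rho g b).
Proof.
rewrite /crossed_mul crossed_ext_single; last by move=> ?; apply: mul_inner2.
by rewrite crossed_ext_single // => ?; apply: mul_inner1.
Qed.

Let comp_zmod (U V W : zmodType) (p : U -> V) (q : V -> W) :
  zmod_morphism p -> zmod_morphism q -> zmod_morphism (q \o p).
Proof. by move=> pB qB x y; rewrite /= pB qB. Qed.

Fact crossed_mulA : associative crossed_mul.
Proof.
move=> f h r; move: f; apply: crossed_ext_eq => [||g a].
- exact: crossed_mulBl.
- exact: comp_zmod (crossed_mulBl h) (crossed_mulBl r).
move: h; apply: crossed_ext_eq => [||k b].
- exact: comp_zmod (crossed_mulBl r) (crossed_mulBr _).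
- exact: comp_zmod (crossed_mulBr _) (crossed_mulBl r).
move: r; apply: crossed_ext_eq => [||l c].
- exact: comp_zmod (crossed_mulBr _) (crossed_mulBr _).
- exact: crossed_mulBr.
by rewrite !crossed_mul_single !mulgA ractM rmorphM mulrA.
Qed.

Fact crossed_mul1 : left_id (single 1%g 1) crossed_mul.
Proof.
apply: crossed_ext_eq => [|//|g a]; first exact: crossed_mulBr.
by rewrite crossed_mul_single mul1g mul1r ract1.
Qed.

Fact crossed_mulr1 : right_id (single 1%g 1) crossed_mul.
Proof.
apply: crossed_ext_eq => [|//|g a]; first exact: crossed_mulBl.
by rewrite crossed_mul_single mulg1 rmorph1 mulr1.
Qed.

Let zmod_morphD (U V : zmodType) (p : U -> V) :
  zmod_morphism p -> {morph p : x y / x + y}.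
Proof.
move=> pB x y; have p0 : p 0 = 0 by rewrite -[X in p X](subrr 0) pB subrr.
have pN z : p (- z) = - p z by rewrite -[in LHS](sub0r z) pB p0 sub0r.
by rewrite -[in LHS](opprK y) pB pN opprK.
Qed.

Fact crossed_mulDl : left_distributive crossed_mul +%R.
Proof. by move=> f h r; apply: zmod_morphD (crossed_mulBl r) _ _. Qed.
Fact crossed_mulDr : right_distributive crossed_mul +%R.
Proof. by move=> f h r; apply: zmod_morphD (crossed_mulBr f) _ _. Qed.
Fact crossed_1neq0 : single 1%g 1 != 0.
Proof.
apply/eqP => /(congr1 (fun f : R => f 1%g)).
by rewrite singleE eqxx crossed0 => /eqP; rewrite oner_eq0.
Qed.

HB.instance Definition _ := GRing.Zmodule_isNzRing.Build R
  crossed_mulA crossed_mul1 crossed_mulr1 crossed_mulDl crossed_mulDr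
  crossed_1neq0.

Lemma crossed1E : 1 = single 1%g 1 :> R. Proof. by []. Qed.

Lemma single_mul g a k b :
  single g a * single k b = single (g * k)%g (a * rho g b).
Proof. exact: crossed_mul_single. Qed.

(* A copy of A carrying the left A * G-module structure (a, g) . b = a * (g . b);
   for A = int with the trivial action it is the trivial Z[G]-module Z. *)
Definition crossed_base (_ : ring_action G A) : Type := A.
Local Notation B := (crossed_base rho).
HB.instance Definition _ := GRing.Zmodule.on B.

Definition crossed_scale (f : R) (b : B) : B :=
  crossed_ext (fun g a => a * rho g b : A) f.

Let scale_inner b g : zmod_morphism (fun a => a * rho g b : A).
Proof. by move=> a c; rewrite mulrBl. Qed.

Let crossed_scaleBl b : zmod_morphism (crossed_scale^~ b).
Proof. by apply: crossed_ext_is_zmod_morphism => g; apply: scale_inner. Qed.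

Let crossed_scaleBr f : zmod_morphism (crossed_scale f).
Proof.
move=> b c; rewrite /crossed_scale -sumrB; apply: eq_bigr => g _.
by rewrite raddfB mulrBr.
Qed.

Let crossed_scale_single g a (b : B) : crossed_scale (single g a) b = a * rho g b :> A.
Proof. by rewrite /crossed_scale crossed_ext_single. Qed.

Fact crossed_scaleA f h b :
  crossed_scale f (crossed_scale h b) = crossed_scale (f * h) b.
Proof.
move: f; apply: crossed_ext_eq => [||g a].
- exact: crossed_scaleBl.
- exact: comp_zmod (crossed_mulBl h) (crossed_scaleBl b).
move: h; apply: crossed_ext_eq => [||k c].
- exact: comp_zmod (crossed_scaleBl b) (crossed_scaleBr _).
- exact: comp_zmod (crossed_mulBr _) (crossed_scaleBl b).
by rewrite single_mul !crossed_scale_single ractM rmorphM mulrA.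
Qed.

Fact crossed_scale1 : left_id 1 crossed_scale.
Proof. by move=> b; rewrite crossed_scale_single ract1 mul1r. Qed.
Fact crossed_scaleDr : right_distributive crossed_scale +%R.
Proof. by move=> f b c; apply: zmod_morphD (crossed_scaleBr f) _ _. Qed.
Fact crossed_scaleDl b : {morph crossed_scale^~ b : f h / f + h}.
Proof. by move=> f h; apply: zmod_morphD (crossed_scaleBl b) _ _. Qed.

HB.instance Definition _ := GRing.Zmodule_isLmodule.Build R B
  crossed_scaleA crossed_scale1 crossed_scaleDr crossed_scaleDl.

Lemma single_scale g a (b : B) : single g a *: b = a * rho g b :> A.
Proof. exact: crossed_scale_single. Qed.

End Crossed.

Section GroupRing.
Variable G : groupType.

Definition trivial_action : ring_action G int :=
  @RingAction G int (fun=> idfun) (fun=> erefl) (fun _ _ _ => erefl).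

Variables (A : comNzRingType) (rho : ring_action G A).

Definition group_ring_incl (f : crossed trivial_action) : crossed rho :=
  crossed_ext (fun g n => single rho g n%:~R) f.

Let incl_inner g : zmod_morphism (fun n : int => single rho g n%:~R).
Proof. by move=> m n; rewrite rmorphB raddfB. Qed.

Fact group_ring_incl_is_zmod_morphism : zmod_morphism group_ring_incl.
Proof. by apply: crossed_ext_is_zmod_morphism => g; apply: incl_inner. Qed.

Lemma group_ring_incl_single g n :
  group_ring_incl (single _ g n) = single rho g n%:~R.
Proof. by rewrite /group_ring_incl crossed_ext_single. Qed.

Let comp_zmod (U V W : zmodType) (p : U -> V) (q : V -> W) :
  zmod_morphism p -> zmod_morphism q -> zmod_morphism (q \o p).
Proof. by move=> pB qB x y; rewrite /= pB qB. Qed.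

Fact group_ring_incl_is_monoid_morphism : monoid_morphism group_ring_incl.
Proof.
split; first by rewrite !crossed1E group_ring_incl_single.
have inclB := group_ring_incl_is_zmod_morphism.
move=> f h; move: f; apply: crossed_ext_eq => [||g m].
- exact: comp_zmod (crossed_mulBl h) inclB.
- exact: comp_zmod inclB (crossed_mulBl _).
move: h; apply: crossed_ext_eq => [||k n].
- exact: comp_zmod (crossed_mulBr _) inclB.
- exact: comp_zmod inclB (crossed_mulBr _).
by rewrite single_mul !group_ring_incl_single single_mul rmorph_int rmorphM.
Qed.

HB.instance Definition _ := GRing.isZmodMorphism.Build _ _ group_ring_incl
  group_ring_incl_is_zmod_morphism.
HB.instance Definition _ := GRing.isMonoidMorphism.Build _ _ group_ring_incl
  group_ring_incl_is_monoid_morphism.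

End GroupRing.

Section Linf.
Context (R : realType) (d : measure_display) (X : measurableType d).
Variable mu : probability X R.

(* Z carries the discrete sigma-algebra. *)
Definition ess_bounded_mfun (f : X -> int) : Prop :=
  (forall B : set int, measurable (f @^-1` B)) /\
  exists M : int, {ae mu, forall x, `|f x| <= M}.

Definition ess_bounded_pred : {pred X -> int} :=
  [pred f | `[< ess_bounded_mfun f >]].

Let meas_op (op : int -> int -> int) (f g : X -> int) (B : set int) :
  (forall B : set int, measurable (f @^-1` B)) ->
  (forall B : set int, measurable (g @^-1` B)) ->
  measurable ((fun x => op (f x) (g x)) @^-1` B).
Proof.
move=> mf mg.
rewrite (_ : _ @^-1` _ = \bigcup_(p in [set: int * int])
    [set x | B (op p.1 p.2) /\ f x = p.1 /\ g x = p.2]); last first.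
  apply/seteqP; split=> [x Bx|x [[m n] _ /= [Bmn [-> ->]]]] //=.
  by exists (f x, g x).
apply: countable_bigcupT_measurable => // -[m n] /=.
have [Bmn|nBmn] := pselect (B (op m n)).
  rewrite (_ : [set _ | _] = f @^-1` [set m] `&` g @^-1` [set n]).
    by apply: measurableI; [exact: mf|exact: mg].
  by apply/seteqP; split => x /= [].
rewrite (_ : [set _ | _] = set0) //.
by apply/seteqP; split => x /= [].
Qed.

Fact ess_bounded_subring_closed : subring_closed ess_bounded_pred.
Proof.
split=> [|f g /asboolP[mf [M fM]] /asboolP[mg [N gN]]
        |f g /asboolP[mf [M fM]] /asboolP[mg [N gN]]]; apply/asboolP; split.
- move=> B; have [B1|nB1] := pselect (B 1).
    by rewrite (_ : _ @^-1` _ = setT) //; apply/seteqP; split.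
  by rewrite (_ : _ @^-1` _ = set0) //; apply/seteqP; split.
- by exists 1; apply: filterE => x; rewrite normr1.
- by move=> B; exact: (@meas_op (fun m n => m - n)).
- exists (M + N); apply: filterS2 fM gN => x fx gx.
  by rewrite (le_trans (ler_normB _ _)) // lerD.
- by move=> B; exact: (@meas_op (fun m n => m * n)).
- exists (M * N); apply: filterS2 fM gN => x fx gx.
  by rewrite normrM ler_pM.
Qed.
HB.instance Definition _ := GRing.isSubringClosed.Build (X -> int)
  ess_bounded_pred ess_bounded_subring_closed.

Record ess_bounded := EssBounded {
  eb_fun :> X -> int;
  eb_funP : eb_fun \in ess_bounded_pred
}.
HB.instance Definition _ := [isSub for eb_fun].
HB.instance Definition _ := [Choice of ess_bounded by <:].
HB.instance Definition _ := [SubChoice_isSubComNzRing of ess_bounded by <:].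

Definition ae_zero : {pred ess_bounded} :=
  [pred f : ess_bounded | `[< {ae mu, forall x, f x = 0} >]].

Fact ae_zero_ideal : idealr_closed ae_zero.
Proof.
split.
- by apply/asboolP/filterE.
- apply/asboolP => h.
  have mu0 : (0 < mu [set: X])%E by rewrite probability_setT.
  have := @filter_ex _ _ (ae_properfilter_algebraOfSetsType mu0) _ h.
  by case=> x.
- move=> f g h /asboolP g0 /asboolP h0; apply/asboolP.
  apply: filterS2 g0 h0 => x /= gx hx.
  by rewrite -[LHS]/(f x * g x + h x) gx hx mulr0 addr0.
Qed.
HB.instance Definition _ := isIdealr.Build ess_bounded ae_zero ae_zero_ideal.

Definition Linf : Type := Quotient.quot ae_zero.
HB.instance Definition _ := GRing.ComNzRing.on Linf.
End Linf.

Section LinfClass.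
Context (R : realType) (d : measure_display) (X : measurableType d).
Variable mu : probability X R.

Definition Linf_class (f : X -> int) (hf : ess_bounded_mfun mu f) : Linf mu :=
  \pi_(Linf mu)%qT (EssBounded (asboolT hf : f \in ess_bounded_pred mu)).

Lemma pi_Linf_eq (f h : ess_bounded mu) :
  \pi_(Linf mu)%qT f = \pi_(Linf mu)%qT h <-> {ae mu, forall x, f x = h x}.
Proof.
split => [/eqP|fh].
  rewrite -Quotient.idealrBE => /asboolP; apply: filterS => x fh.
  by apply/eqP; rewrite -subr_eq0; apply/eqP.
apply/eqP; rewrite -Quotient.idealrBE; apply/asboolP.
by apply: filterS fh => x fh; rewrite -[LHS]/(f x - h x) fh subrr.
Qed.

Lemma Linf_classP (f h : X -> int) (hf : ess_bounded_mfun mu f)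
    (hh : ess_bounded_mfun mu h) :
  Linf_class hf = Linf_class hh <-> {ae mu, forall x, f x = h x}.
Proof. exact: pi_Linf_eq. Qed.

Fact ess_bounded_indic (A : set X) :
  measurable A -> ess_bounded_mfun mu (\1_A : X -> int).
Proof.
move=> mA; split.
  by move=> B; rewrite preimage_indic; case: ifP; case: ifP => // _ _; exact: measurableC.
by exists 1; apply: filterE => x; rewrite indicE; case: (x \in A).
Qed.

Definition Linf_chi (A : set X) (mA : measurable A) : Linf mu :=
  Linf_class (ess_bounded_indic mA).

Fact ess_bounded_cst (n : int) : ess_bounded_mfun mu (cst n).
Proof.
split=> [B|]; last by exists `|n|; apply: filterE.
by rewrite preimage_cst; case: ifP.
Qed.

Definition Linf_cst (n : int) : Linf mu := Linf_class (ess_bounded_cst n).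

Lemma Linf_cstE (n : int) : Linf_cst n = n%:~R.
Proof.
rewrite -(rmorph_int (\pi_(Linf mu)%qT : {rmorphism ess_bounded mu -> Linf mu})).
apply/pi_Linf_eq/filterE => x /=.
rewrite -[(n%:~R : ess_bounded mu) x]/(val (n%:~R : ess_bounded mu) x) rmorph_int.
have natx (k : nat) : (k%:R : X -> int) x = k.
  elim: k => [//|k IH]; rewrite -nat1r intS.
  by rewrite -[LHS]/(1 + (k%:R : X -> int) x) IH.
case: n => k; first by rewrite -pmulrn natx.
by rewrite NegzE mulrNz -pmulrn -[RHS]/(- ((k.+1%:R : X -> int) x)) natx.
Qed.

End LinfClass.

(* The measurable sets are the Borel sets of a Polish metric on X. *)
Definition standard_borel (R : realType) (d : measure_display)
    (X : measurableType d) : Prop :=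
  exists (T : metricType R) (h : X -> T),
    [/\ forall F : set_system T, ProperFilter F -> cauchy F -> exists l : T, F --> l,
        exists2 D : set T, countable D & dense D,
        bijective h &
        forall A : set X, measurable A <->
          exists2 B : set T, <<s (@open T) >> B & A = h @^-1` B].

Record standard_action (R : realType) (d : measure_display)
    (X : measurableType d) (mu : probability X R) (G : groupType) :=
  StandardAction {
  sact :> G -> X -> X;
  sact_countable : countable [set: G];
  sact_borel : standard_borel R X;
  sact1 : forall x, sact 1%g x = x;
  sactM : forall g h x, sact (g * h)%g x = sact g (sact h x);
  sact_measurable : forall g, measurable_fun setT (sact g);
  sact_preserving : forall g (B : set X), measurable B ->
    mu (sact g @^-1` B) = mu B;
  sact_free : {ae mu, forall x, forall g, sact g x = x -> g = 1%g}
}.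

Section LinfAction.
Context (R : realType) (d : measure_display) (X : measurableType d).
Context (mu : probability X R) (G : groupType).
Variable alpha : standard_action mu G.

Let sact_ae (P : X -> Prop) (g : G) :
  {ae mu, forall x, P x} -> {ae mu, forall x, P (alpha g x)}.
Proof.
move=> [N [mN N0 PN]]; exists (alpha g @^-1` N); split.
- by rewrite -[X in measurable X]setTI; exact: sact_measurable.
- by rewrite sact_preserving.
- by move=> x /= nP; exact: PN.
Qed.

Fact ess_bounded_translate (g : G) (f : X -> int) :
  ess_bounded_mfun mu f -> ess_bounded_mfun mu (fun x => f (alpha g^-1%g x)).
Proof.
move=> [mf [M fM]]; split; last first.
  by exists M; exact: (sact_ae (P := fun x => `|f x| <= M)).
move=> B; rewrite -[X in measurable X]setTI.
exact: (sact_measurable alpha g^-1%g measurableT (mf B)).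
Qed.

Definition eb_translate (g : G) (f : ess_bounded mu) : ess_bounded mu :=
  EssBounded (asboolT (ess_bounded_translate g (asboolW (eb_funP f)))
    : _ \in ess_bounded_pred mu).

Definition Linf_translate (g : G) (u : Linf mu) : Linf mu :=
  \pi_(Linf mu)%qT (eb_translate g (repr u)).

Lemma Linf_translate_pi g (f : ess_bounded mu) :
  Linf_translate g (\pi_(Linf mu)%qT f) = \pi_(Linf mu)%qT (eb_translate g f).
Proof.
apply/pi_Linf_eq; apply: (sact_ae (P := fun x => repr (\pi_(Linf mu)%qT f) x = f x)).
by apply/pi_Linf_eq; rewrite reprK.
Qed.

Lemma Linf_translateE g (f : X -> int) (hf : ess_bounded_mfun mu f) :
  Linf_translate g (Linf_class hf) = Linf_class (ess_bounded_translate g hf).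
Proof. by rewrite Linf_translate_pi; apply/pi_Linf_eq/filterE. Qed.

Fact Linf_translate_is_zmod_morphism g : zmod_morphism (Linf_translate g).
Proof.
move=> u v; rewrite -[u]reprK -[v]reprK -rmorphB !Linf_translate_pi -rmorphB.
by apply/pi_Linf_eq/filterE.
Qed.

Fact Linf_translate_is_monoid_morphism g : monoid_morphism (Linf_translate g).
Proof.
split.
  rewrite -(rmorph1 (\pi_(Linf mu)%qT : {rmorphism ess_bounded mu -> Linf mu})).
  by rewrite Linf_translate_pi; apply/pi_Linf_eq/filterE.
move=> u v; rewrite -[u]reprK -[v]reprK -rmorphM !Linf_translate_pi -rmorphM.
by apply/pi_Linf_eq/filterE.
Qed.

HB.instance Definition _ g := GRing.isZmodMorphism.Build _ _ (Linf_translate g)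
  (Linf_translate_is_zmod_morphism g).
HB.instance Definition _ g := GRing.isMonoidMorphism.Build _ _ (Linf_translate g)
  (Linf_translate_is_monoid_morphism g).

Fact Linf_translate1 u : Linf_translate 1%g u = u.
Proof.
rewrite -[u]reprK Linf_translate_pi; apply/pi_Linf_eq/filterE => x /=.
by rewrite invg1 sact1.
Qed.

Fact Linf_translateM g h u :
  Linf_translate (g * h)%g u = Linf_translate g (Linf_translate h u).
Proof.
elim/quotW: u => f; rewrite (Linf_translate_pi h f) !Linf_translate_pi.
apply/pi_Linf_eq/filterE => x.
by rewrite /= invgM sactM.
Qed.

Definition Linf_action : ring_action G (Linf mu) :=
  @RingAction G (Linf mu) (fun g => Linf_translate g)
    Linf_translate1 Linf_translateM.

End LinfAction.

Section DirectSum.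
Variables (S : nzRingType) (I : finType) (e : I -> S).

(* The direct sum of the left ideals S (e i), inside the free module S^I. *)
Definition dsum_pred : {pred {ffun I -> S^o}} :=
  [pred f : {ffun I -> S^o} | `[< forall i, exists r : S, f i = r * e i >]].

Fact dsum_submod_closed : submod_closed dsum_pred.
Proof.
split=> [|a f h /asboolP fP /asboolP hP]; apply/asboolP => i.
  by exists 0; rewrite ffunE mul0r.
have [[r fr] [s hs]] := (fP i, hP i).
by exists (a * r + s); rewrite !ffunE fr hs mulrDl -mulrA.
Qed.
HB.instance Definition _ := GRing.isSubmodClosed.Build S {ffun I -> S^o}
  dsum_pred dsum_submod_closed.

Record dsum_ideal := DsumIdeal {
  dsum_fun :> {ffun I -> S^o};
  dsum_funP : dsum_fun \in dsum_pred
}.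
HB.instance Definition _ := [isSub for dsum_fun].
HB.instance Definition _ := [Choice of dsum_ideal by <:].
HB.instance Definition _ := [SubChoice_isSubLmodule of dsum_ideal by <:].

End DirectSum.

Section Modules.
Variable S : nzRingType.

Definition projective (P : lmodType S) : Prop :=
  forall (M N : lmodType S) (p : {linear M -> N}) (f : {linear P -> N}),
    (forall y, exists x, p x = y) ->
    exists h : {linear P -> M}, forall x, p (h x) = f x.

Definition finitely_generated (M : lmodType S) : Prop :=
  exists (n : nat) (e : 'I_n -> M),
    forall m, exists c : 'I_n -> S, m = \sum_i c i *: e i.

Definition free_module (M : lmodType S) : Prop :=
  exists (I : choiceType) (e : I -> M),
    forall m, exists! c : {fsfun I -> S with 0},
      m = \sum_(i <- finsupp c) c i *: e i.

Record chain_complex := ChainComplex {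
  cobj :> nat -> lmodType S;
  cdiff : forall k, {linear cobj k.+1 -> cobj k};
  cdiff_comp : forall k x, cdiff k (cdiff k.+1 x) = 0
}.

Record augmented_complex (M : lmodType S) := AugmentedComplex {
  acomplex :> chain_complex;
  augm : {linear acomplex 0 -> M};
  augm_surj : forall m, exists x, augm x = m;
  augm_diff : forall x, augm (cdiff acomplex 0 x) = 0
}.

Definition is_resolution (M : lmodType S) (C : augmented_complex M) : Prop :=
  (forall x, augm C x = 0 -> exists y, cdiff C 0 y = x) /\
  (forall k x, cdiff C k x = 0 -> exists y, cdiff C k.+1 y = x).

End Modules.

Notation group_ring G := (crossed (trivial_action G)).
Notation trivial_module G := (crossed_base (trivial_action G)).

Definition type_FP (G : groupType) (m : nat) : Prop :=
  exists P : augmented_complex (trivial_module G),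
    [/\ is_resolution P,
        forall k, projective (P k) &
        forall k, (k <= m)%N -> finitely_generated (P k)].

Record free_resolution (G : groupType) := FreeResolution {
  fr_complex :> augmented_complex (trivial_module G);
  fr_exact : is_resolution fr_complex;
  fr_free : forall k, free_module (fr_complex k)
}.

Section Cost.
Context (R : realType) (d : measure_display) (X : measurableType d).
Context (mu : probability X R) (G : groupType).
Variable alpha : standard_action mu G.

Definition orbit_rel (x y : X) : Prop := exists g : G, y = alpha g x.

Definition partial_iso (A B : set X) (phi : X -> X) : Prop :=
  [/\ measurable A, measurable B, set_bij A B phi, measurable_fun A phi &
      forall C : set X, measurable C -> C `<=` A -> measurable (phi @` C)].

(* Every countable family is indexed by nat after padding with empty partial
   isomorphisms, which change neither the generated relation nor the cost. *)
Record graphing := Graphing {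
  gr_dom : nat -> set X;
  gr_cod : nat -> set X;
  gr_map : nat -> X -> X;
  gr_iso : forall i, partial_iso (gr_dom i) (gr_cod i) (gr_map i);
  gr_orbit : forall i x, gr_dom i x -> orbit_rel x (gr_map i x);
  gr_generates : {ae mu, forall x, forall y,
    clos_refl_sym_trans X
      (fun u v => exists2 i, gr_dom i u & v = gr_map i u) x y <->
    orbit_rel x y}
}.

Definition graphing_cost (Phi : graphing) : \bar R :=
  (\sum_(0 <= i <oo) mu (gr_dom Phi i))%E.

Definition cost : \bar R := ereal_inf [set graphing_cost Phi | Phi in [set: graphing]].

End Cost.

Section Medim.
Context (R : realType) (d : measure_display) (X : measurableType d).
Context (mu : probability X R) (G : groupType).
Variable alpha : standard_action mu G.

Notation crossed_ring := (crossed (Linf_action alpha)).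
Notation Linf_module := (crossed_base (Linf_action alpha)).

Record marking (M : lmodType crossed_ring) := Marking {
  mk_index : finType;
  mk_set : mk_index -> set X;
  mk_measurable : forall i, measurable (mk_set i);
  mk_iso : {linear M -> dsum_ideal (fun i =>
    single (Linf_action alpha) 1%g (Linf_chi mu (mk_measurable i)))};
  mk_bij : bijective mk_iso
}.

Definition marked_dim (M : lmodType crossed_ring) (m : marking M) : \bar R :=
  (\sum_(i : mk_index m) mu (mk_set i))%E.

Record marked_complex := MarkedComplex {
  mc_complex :> augmented_complex Linf_module;
  mc_marking : forall k, marking (mc_complex k)
}.

(* Only f 0, ..., f n.+1 are constrained: the higher components are irrelevant
   and can be taken to be zero. *)
Definition alpha_embedding (n : nat) (C : free_resolution G)
    (D : marked_complex) : Prop :=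
  exists f : forall k,
      {linear C k -> D k | (group_ring_incl (Linf_action alpha) \; *:%R)},
    (forall k, (k <= n)%N ->
       forall x, f k (cdiff C k x) = cdiff D k (f k.+1 x)) /\
    (forall x, augm D (f 0%N x) = Linf_cst mu (augm C x)).

Definition medim (n : nat) (C : free_resolution G) : \bar R :=
  ereal_inf [set v | exists2 D : marked_complex,
    alpha_embedding n C D & v = marked_dim (mc_marking D n)].

End Medim.

(* Main.v *)
Require Import Defs.
From HB Require Import structures.
From mathcomp Require Import all_boot all_order all_algebra.
From mathcomp Require Import finmap.
From mathcomp Require Import all_classical all_reals all_analysis.
From Stdlib Require Import Relation_Operators.
Set Implicit Arguments.
Unset Strict Implicit.
Unset Printing Implicit Defensive.
Import Order.TTheory GRing.Theory Num.Theory.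
Local Open Scope classical_set_scope.
Local Open Scope ring_scope.

(** The inequality holds because a finite marked complex computing enough of
    the homology of the orbit relation can be read off from a graphing, and
    because a graph with a spanning forest has one edge too many per vertex
    that is not a root.

    Write [RR] for the crossed product, [chiR A] for the idempotent of [A] and
    [grpR g] for the group element [g].  A graphing is cut into edges
    [x |-> g_n^-1 x], [x] in [E_n], whose total measure is at most its cost
    ([graphing_edges]); such an edge is the element
    [chiR (E n) * (grpR (g_n) - 1)].  For a fixed [s], almost every [x] is
    joined to [s^-1 x] by an edge path, and since there are countably many
    paths, finitely many of them are enough outside a set of small measure.
    Hence, on the complement of that small set, [grpR s - 1] is in the left
    ideal of finitely many edges ([reach_span], [reach_large]); the small set is
    added as one more edge [x |-> s^-1 x].  So the complex
    [(+) <E_n> (+) <small sets> -> RR -> L^oo] has any prescribed finite number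
    of elements [grpR s - 1] in the image of its differential, and its term of
    degree 1 has dimension at most the cost plus [eps].

    The summand [-1] comes from contracting a spanning forest.  Since [G] is
    infinite and acts freely, there is a set [A0] of measure at most [eps] that
    meets every orbit ([small_section]).  Growing [A0] along finitely many edges
    exhausts [X] up to measure [eps].  Each newly reached point uses up one
    point of one edge domain, so the used parts [B n] of the [E n] have total
    measure at least [1 - 2 eps].  Sending each point to the root of its tree is
    right multiplication by an element [p] of [RR] with [p 1 = 1], and edges
    within a tree become loops: [chiR (B n) * (grpR (g_n) - 1) * p = 0]
    ([forest_retraction_grow]).  Therefore, after replacing the differential
    by its product with [p], the parts [B n] can be dropped from the domains
    without changing the image.  The term [RR] in degree 0 is kept: only the
    dimension in degree 1 is measured.

    It remains to map a free resolution [C] into this complex.  It maps first to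
    a resolution [P] that is finitely generated in degrees [<= 2]
    ([resolution_lift]), and dual bases ([projective_dual_basis]) give explicit
    formulas for the maps out of [P 0], [P 1] and [P 2].  The boundaries of the
    generators of [P 1] are mapped to finitely many elements of the
    augmentation ideal of [Z G], which provide the finite set of group elements
    [s] above.  Finite generation of [P 2] allows the choice of a finite free
    module in degree 2 ([FP2_embedding]). *)

(** * Lifting along free and projective modules *)

Section FreeLift.
Local Open Scope fset_scope.
Local Open Scope ring_scope.
Variable S : nzRingType.

Section Combinations.
Variable I : choiceType.
Implicit Types c d : {fsfun I -> S with 0}.

Definition fs_lincomb (V : lmodType S) (v : I -> V) c : V :=
  \sum_(i <- finsupp c) c i *: v i.

Definition fs_scale_add (a : S) c d : {fsfun I -> S with 0} :=
  [fsfun i in finsupp c `|` finsupp d => a * c i + d i].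

Lemma fs_scale_addE a c d i : fs_scale_add a c d i = a * c i + d i.
Proof.
rewrite fsfunE inE !mem_finsupp.
by case: eqP => [->|//]; case: eqP => [->|//]; rewrite mulr0 addr0.
Qed.

Lemma fs_lincomb_incl (V : lmodType S) (v : I -> V) c (A : {fset I}) :
  finsupp c `<=` A -> fs_lincomb v c = \sum_(i <- A) c i *: v i.
Proof.
move=> sfA; apply: big_fset_incl => // i _ ci.
by rewrite fsfun_dflt ?scale0r.
Qed.

Lemma fs_lincomb_scale_add (V : lmodType S) (v : I -> V) a c d :
  fs_lincomb v (fs_scale_add a c d) = a *: fs_lincomb v c + fs_lincomb v d.
Proof.
pose A := finsupp c `|` finsupp d.
rewrite (@fs_lincomb_incl _ v c A) ?fsubsetUl //.
rewrite (@fs_lincomb_incl _ v d A) ?fsubsetUr //.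
rewrite (@fs_lincomb_incl _ v _ A); last first.
  apply/fsubsetP => i; rewrite /A inE !mem_finsupp fs_scale_addE -negb_and.
  apply: contra => /andP[/eqP -> /eqP ->].
  by rewrite mulr0 addr0.
rewrite scaler_sumr -big_split; apply: eq_bigr => i _ /=.
by rewrite fs_scale_addE scalerDl scalerA.
Qed.

End Combinations.

(** The surjectivity of [p] is only required over the image of [f]: the lift is
    chosen on a basis.  This avoids restricting [p] to the submodule of cycles
    when it is applied to a resolution. *)
Lemma free_lift (F M N : lmodType S) (p : {linear M -> N})
    (f : {linear F -> N}) :
  free_module F -> (forall x, exists y, p y = f x) ->
  exists h : {linear F -> M}, forall x, p (h x) = f x.
Proof.
move=> [I [e eP]] pf.
have {}eP : forall m, exists c : {fsfun I -> S with 0},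
    m = fs_lincomb e c /\ forall d, m = fs_lincomb e d -> c = d.
  by move=> m; have [c [mc uc]] := eP m; exists c.
have /choice[c cP] := eP.
have /choice[y yP] := fun i => pf (e i).
pose h x := fs_lincomb y (c x).
have cL a u v : c (a *: u + v) = fs_scale_add a (c u) (c v).
  apply: (cP _).2; rewrite fs_lincomb_scale_add.
  by rewrite -(cP u).1 -(cP v).1.
have hL : linear h by move=> a u v; rewrite /h cL fs_lincomb_scale_add.
pose H : {linear F -> M} := HB.pack h (GRing.isLinear.Build S F M *:%R h hL).
exists H => x; rewrite -[H x]/(h x) /h [in RHS](cP x).1 /fs_lincomb.
rewrite !linear_sum /=.
by apply: eq_bigr => i _; rewrite !linearZ /= yP.
Qed.

End FreeLift.

Section DualBasis.
Variable S : nzRingType.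

Lemma lincomb_linear (I : finType) (V : lmodType S) (v : I -> V) :
  exists q : {linear {ffun I -> S^o} -> V}, forall a, q a = \sum_i a i *: v i.
Proof.
pose q (a : {ffun I -> S^o}) := \sum_i (a i : S) *: v i.
have qL : linear q.
  move=> a f h; rewrite /q scaler_sumr -big_split; apply: eq_bigr => i _ /=.
  by rewrite !ffunE scalerDl scalerA.
pose Q : {linear {ffun I -> S^o} -> V} :=
  HB.pack q (GRing.isLinear.Build S _ V *:%R q qL).
by exists Q.
Qed.

(** The coordinates are the components of a splitting of the surjection from a
    finite free module given by the generators. *)
Lemma projective_dual_basis (P : lmodType S) :
  projective P -> finitely_generated P ->
  exists n (e : 'I_n -> P) (s : 'I_n -> {linear P -> S^o}),
    forall x, x = \sum_i (s i x : S) *: e i.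
Proof.
move=> projP [n [e eP]]; exists n, e.
have [q qE] := lincomb_linear e.
have [|h hP] := projP _ _ q (idfun : {linear P -> P}).
  move=> y; have [c ->] := eP y; exists [ffun i => c i : S^o].
  by rewrite qE; apply: eq_bigr => i _; rewrite ffunE.
have sL i : linear (fun x => h x i : S^o).
  by move=> a u v; rewrite linearP !ffunE.
pose s i : {linear P -> S^o} :=
  HB.pack (fun x => h x i : S^o) (GRing.isLinear.Build S P _ *:%R _ (sL i)).
exists s.
by move=> x; rewrite -[LHS](hP x) qE.
Qed.

Lemma resolution_lift (M : lmodType S) (C P : augmented_complex M) :
  (forall k, free_module (C k)) -> is_resolution P ->
  exists (h0 : {linear C 0%N -> P 0%N}) (h1 : {linear C 1%N -> P 1%N})
         (h2 : {linear C 2%N -> P 2%N}),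
  [/\ forall x, augm P (h0 x) = augm C x,
      forall x, cdiff P 0 (h1 x) = h0 (cdiff C 0 x) &
      forall x, cdiff P 1 (h2 x) = h1 (cdiff C 1 x)].
Proof.
move=> freeC [exP0 exP].
have [h0 h0P] :=
  free_lift (f := augm C) (freeC 0%N) (fun x => @augm_surj S M P _).
have [|h1 h1P] :=
  free_lift (p := cdiff P 0) (f := (h0 \o cdiff C 0)) (freeC 1%N).
  by move=> x; apply: exP0; rewrite /= h0P (@augm_diff S M C).
have [|h2 h2P] :=
  free_lift (p := cdiff P 1) (f := (h1 \o cdiff C 1)) (freeC 2%N).
  by move=> x; apply: exP; rewrite /= h1P /= (@cdiff_comp S C) linear0.
by exists h0, h1, h2.
Qed.

End DualBasis.

(** * Sets and group elements in the crossed product *)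

Section Corners.
Context (R : realType) (d : measure_display) (X : measurableType d).
Context (mu : probability X R) (G : groupType).
Variable alpha : standard_action mu G.
Implicit Types (A B : set X) (g h : G).

(** A total version of [Linf_chi], which depends on the set alone, so that sets
    can be rewritten in it. *)
Definition chi A : Linf mu :=
  if pselect (measurable A) is left mA then Linf_chi mu mA else 0.

Lemma chiE A (mA : measurable A) : chi A = Linf_chi mu mA.
Proof.
rewrite /chi; case: pselect => // mA'.
by apply/Linf_classP/filterE.
Qed.

Lemma chi_setT : chi setT = 1.
Proof.
have <- : Linf_cst mu 1 = 1 by rewrite Linf_cstE.
rewrite (chiE measurableT); apply/Linf_classP/filterE => x.
by rewrite indicT.
Qed.

Lemma chi_set0 : chi set0 = 0.
Proof.
have <- : Linf_cst mu 0 = 0 by rewrite Linf_cstE.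
rewrite (chiE measurable0); apply/Linf_classP/filterE => x.
by rewrite indic0.
Qed.

Lemma chiI A B : measurable A -> measurable B ->
  chi A * chi B = chi (A `&` B).
Proof.
move=> mA mB; rewrite (chiE mA) (chiE mB) (chiE (measurableI _ _ mA mB)).
rewrite /Linf_chi /Linf_class -rmorphM; apply/pi_Linf_eq/filterE => x /=.
by rewrite -[LHS]/(\1_A x * \1_B x) indicI.
Qed.

Lemma chiU A B : measurable A -> measurable B -> A `&` B = set0 ->
  chi A + chi B = chi (A `|` B).
Proof.
move=> mA mB AB0; rewrite (chiE mA) (chiE mB) (chiE (measurableU _ _ mA mB)).
rewrite /Linf_chi /Linf_class -rmorphD; apply/pi_Linf_eq/filterE => x /=.
rewrite -[LHS]/(\1_A x + \1_B x) !indicE in_setU.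
have : x \notin A `&` B by rewrite AB0 in_set0.
by rewrite in_setI; case: (x \in A); case: (x \in B).
Qed.

(** The translate of [A] by [g]. *)
Definition gset g A : set X := alpha g^-1%g @^-1` A.

Lemma measurable_gset g A : measurable A -> measurable (gset g A).
Proof.
by move=> mA; rewrite -[gset g A]setTI; exact: (sact_measurable alpha g^-1%g).
Qed.

Lemma mu_gset g A : measurable A -> mu (gset g A) = mu A.
Proof. exact: sact_preserving. Qed.

Lemma translate_chi g A : measurable A ->
  Linf_action alpha g (chi A) = chi (gset g A).
Proof.
move=> mA; rewrite (chiE mA) (chiE (measurable_gset g mA)).
rewrite -[LHS]/(Linf_translate alpha g (Linf_chi mu mA)) Linf_translateE.
by apply/Linf_classP/filterE.
Qed.

Local Notation RR := (crossed (Linf_action alpha)).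
Local Notation LL := (crossed_base (Linf_action alpha)).

Definition chiR A : RR := single (Linf_action alpha) 1%g (chi A).
Definition grpR g : RR := single (Linf_action alpha) g 1.

Lemma chiR_setT : chiR setT = 1. Proof. by rewrite /chiR chi_setT. Qed.

Lemma chiRM A B : measurable A -> measurable B ->
  chiR A * chiR B = chiR (A `&` B).
Proof. by move=> mA mB; rewrite single_mul mulg1 ract1 chiI. Qed.

Lemma chiRD A B : measurable A -> measurable B -> A `&` B = set0 ->
  chiR (A `|` B) = chiR A + chiR B.
Proof. by move=> mA mB AB; rewrite /chiR -chiU // raddfD. Qed.

Lemma chiR_set0 : chiR set0 = 0.
Proof. by rewrite /chiR chi_set0 raddf0. Qed.

Lemma chiR_idem A B : measurable A -> measurable B -> A `<=` B ->
  chiR A * chiR B = chiR A.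
Proof. by move=> mA mB /setIidPl AB; rewrite chiRM // AB. Qed.

Lemma chiR_ortho A B : measurable A -> measurable B -> A `&` B = set0 ->
  chiR A * chiR B = 0.
Proof. by move=> mA mB AB; rewrite chiRM // AB chiR_set0. Qed.

Lemma grpRM g h : grpR g * grpR h = grpR (g * h)%g.
Proof. by rewrite single_mul mul1r rmorph1. Qed.

Lemma grpR1 : grpR 1%g = 1. Proof. by []. Qed.

Lemma grpR_chiR g A : measurable A ->
  grpR g * chiR A = chiR (gset g A) * grpR g.
Proof.
move=> mA; rewrite !single_mul mulg1 mul1g mul1r rmorph1 mulr1.
by rewrite translate_chi.
Qed.

Lemma chiR_scale A (b : LL) : chiR A *: b = chi A * (b : Linf mu) :> Linf mu.
Proof. by rewrite single_scale ract1. Qed.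

Lemma grpR_scale g (b : LL) : grpR g *: b = Linf_action alpha g b :> Linf mu.
Proof. by rewrite single_scale mul1r. Qed.

End Corners.

(** * Edges, edge paths and spanning forests *)

Section Forest.
Context (R : realType) (d : measure_display) (X : measurableType d).
Context (mu : probability X R) (G : groupType).
Variable alpha : standard_action mu G.
Implicit Types (A B D U V : set X) (g h : G).

Local Notation RR := (crossed (Linf_action alpha)).
Local Notation LL := (crossed_base (Linf_action alpha)).
Local Notation chiR := (chiR alpha).
Local Notation grpR := (grpR alpha).
Local Notation gset := (gset alpha).
Local Notation one := (1 : Linf mu).

(** The element [chiR V * (grpR h - 1)] stands for the edges [x |-> h^-1 x] with
    [x] in [V].  If both ends of these edges are in [U], it does not see what
    happens outside [U]. *)
Lemma chiR_diff_ortho U D V h : measurable D -> measurable V ->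
  V `<=` U -> V `<=` gset h U -> D `&` U = set0 ->
  chiR V * (grpR h - 1) * chiR D = 0.
Proof.
move=> mD mV VU VhU DU.
have VD : V `&` D = set0.
  by rewrite -subset0 -DU => x [/VU Ux Dx].
have VhD : V `&` gset h D = set0.
  rewrite -subset0 => x [/VhU Vx Dx].
  have : (D `&` U) (alpha h^-1%g x) by [].
  by rewrite DU.
have mhD := measurable_gset alpha h mD.
rewrite mulrBr mulr1 mulrBl -mulrA grpR_chiR // mulrA.
by rewrite !chiR_ortho // mul0r subrr.
Qed.

(** Here [p] sends each point of [U] to a root, and the points of [D] are hung
    onto [U] by the edges [x |-> g^-1 x].  The extended [p'] sends [x] in [D] to
    the root of [g^-1 x], so that these edges become loops, and edges that
    were loops before remain so because both of their ends are in [U]. *)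
Lemma attach_to_forest U D g (p : RR) : measurable U -> measurable D ->
  D `&` U = set0 -> D `<=` gset g U ->
  chiR U * p = p -> p *: (one : LL) = chi mu U ->
  let p' := p + chiR D * grpR g * p in
  [/\ chiR (U `|` D) * p' = p',
      p' *: (one : LL) = chi mu (U `|` D),
      chiR D * (grpR g - 1) * p' = 0 &
      forall V h, measurable V -> V `<=` U -> V `<=` gset h U ->
        chiR V * (grpR h - 1) * p = 0 -> chiR V * (grpR h - 1) * p' = 0].
Proof.
move=> mU mD DU DgU Up p1 p'.
have UD : U `&` D = set0 by rewrite setIC.
have mgU := measurable_gset alpha g mU.
have mgD := measurable_gset alpha g mD.
have Dp : chiR D * p = 0 by rewrite -Up mulrA chiR_ortho // mul0r.
split.
- rewrite chiRD // mulrDl !mulrDr !mulrA Up Dp.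
  rewrite (chiR_ortho alpha mU mD) // !mul0r.
  by rewrite (chiR_idem alpha mD mD) // addr0 add0r.
- rewrite scalerDl p1 -!scalerA p1 chiR_scale grpR_scale translate_chi //.
  by rewrite chiI //; move/setIidPl: DgU => ->; rewrite chiU.
- rewrite mulrBr mulr1 mulrBl mulrDr mulrDr Dp add0r.
  rewrite !mulrA (chiR_idem alpha mD mD) //.
  rewrite -(mulrA (chiR D) (grpR g) (chiR D)) grpR_chiR //.
  rewrite !mulrA (chiR_ortho alpha mD mgD) ?mul0r ?addr0 ?subrr //.
  rewrite -subset0 => x [/DgU Dx Dgx].
  have : (D `&` U) (alpha g^-1%g x) by [].
  by rewrite DU.
- move=> V h mV VU VhU Vp; rewrite mulrDr Vp add0r !mulrA.
  by rewrite (chiR_diff_ortho mD mV VU VhU DU) !mul0r.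
Qed.

Variables (E : nat -> set X) (gam : nat -> G).
Hypothesis mE : forall n, measurable (E n).

(** The edge [n] is the partial map [x |-> (gam n)^-1 x] on [E n]; the boolean
    marks that it is traversed backwards.  In both directions an oriented edge
    [e] is the map [x |-> (edge_lab e)^-1 x] on [edge_dom e]. *)
Definition edge_dom (e : nat * bool) : set X :=
  if e.2 then gset (gam e.1)^-1%g (E e.1) else E e.1.
Definition edge_lab (e : nat * bool) : G :=
  if e.2 then (gam e.1)^-1%g else gam e.1.

Lemma measurable_edge_dom e : measurable (edge_dom e).
Proof. by rewrite /edge_dom; case: ifP => // _; exact: measurable_gset. Qed.

(** The points from which the path [w] can be followed, its first edge being the
    head of the list; the path leads from [x] to [(word_lab w)^-1 x]. *)
Fixpoint word_dom (w : seq (nat * bool)) : set X :=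
  if w is e :: w' then edge_dom e `&` gset (edge_lab e) (word_dom w') else setT.
Fixpoint word_lab (w : seq (nat * bool)) : G :=
  if w is e :: w' then (edge_lab e * word_lab w')%g else 1%g.

Lemma measurable_word_dom w : measurable (word_dom w).
Proof.
elim: w => //= e w IH; apply: measurableI; first exact: measurable_edge_dom.
exact: measurable_gset.
Qed.

Lemma word_dom_cat w v x :
  word_dom w x -> word_dom v (alpha (word_lab w)^-1%g x) ->
  word_dom (w ++ v) x.
Proof.
elim: w x => [|e w IH] x /=; first by rewrite invg1 sact1.
move=> [ex wx]; rewrite invgM sactM => vx; split => //.
exact: IH.
Qed.

Lemma word_lab_cat w v : word_lab (w ++ v) = (word_lab w * word_lab v)%g.
Proof. by elim: w => [|e w IH] /=; rewrite ?mul1g // IH mulgA. Qed.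

Definition edge_rev (e : nat * bool) := (e.1, ~~ e.2).

Lemma edge_rev_lab e : edge_lab (edge_rev e) = (edge_lab e)^-1%g.
Proof. by case: e => n [] /=; rewrite /edge_lab //= invgK. Qed.

Lemma edge_rev_dom e x : edge_dom e x ->
  edge_dom (edge_rev e) (alpha (edge_lab e)^-1%g x).
Proof.
case: e => n [] //=; rewrite /edge_dom /edge_lab /gset /=.
by rewrite -sactM invgK mulgV sact1.
Qed.

Lemma word_rev w x : word_dom w x -> exists v,
  word_dom v (alpha (word_lab w)^-1%g x) /\ word_lab v = (word_lab w)^-1%g.
Proof.
elim: w x => [|e w IH] x /=; first by exists [::]; rewrite invg1.
move=> [ex /IH[v [vx vl]]]; exists (v ++ [:: edge_rev e]).
rewrite word_lab_cat /= vl mulg1 edge_rev_lab invgM; split => //.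
rewrite sactM; apply: word_dom_cat => //=; split => //.
by rewrite vl -sactM invgK mulgV sact1; exact: edge_rev_dom.
Qed.

Definition edge_span (N : nat) (r : RR) : Prop :=
  exists a : nat -> RR,
    r = \sum_(n < N) a n * (chiR (E n) * (grpR (gam n) - 1)).

Lemma edge_span0 N : edge_span N 0.
Proof. by exists (fun=> 0); rewrite big1 // => i _; rewrite mul0r. Qed.

Lemma edge_spanD N r s : edge_span N r -> edge_span N s -> edge_span N (r + s).
Proof.
move=> [a ->] [b ->]; exists (fun n => a n + b n).
by rewrite -big_split; apply: eq_bigr => i _ /=; rewrite mulrDl.
Qed.

Lemma edge_spanM N c r : edge_span N r -> edge_span N (c * r).
Proof.
move=> [a ->]; exists (fun n => c * a n).
by rewrite mulr_sumr; apply: eq_bigr => i _ /=; rewrite mulrA.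
Qed.

Lemma edge_span_le N M r : (N <= M)%N -> edge_span N r -> edge_span M r.
Proof.
move=> NM [a ->]; exists (fun n => if (n < N)%N then a n else 0).
rewrite (big_ord_widen M (fun n => a n * (chiR (E n) * (grpR (gam n) - 1)))) //.
rewrite big_mkcond; apply: eq_bigr => i _ /=.
by case: ifP => // _; rewrite mul0r.
Qed.

Lemma edge_span_fwd n : edge_span n.+1 (chiR (E n) * (grpR (gam n) - 1)).
Proof.
exists (fun m => if m == n then 1 else 0); rewrite big_ord_recr /= eqxx mul1r.
rewrite big1 ?add0r // => i _; rewrite ltn_eqF ?mul0r //.
Qed.

Lemma grpR_rev g D : measurable D ->
  chiR (gset g D) * (grpR g - 1) = - grpR g * (chiR D * (grpR g^-1%g - 1)).
Proof.
move=> mD; rewrite !mulrBr !mulr1 !mulNr opprK addrC !mulrA grpR_chiR //.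
by congr (_ + _); rewrite -mulrA grpRM mulgV grpR1 mulr1.
Qed.

Lemma edge_span_edge e :
  edge_span e.1.+1 (chiR (edge_dom e) * (grpR (edge_lab e) - 1)).
Proof.
case: e => n [] /=; rewrite /edge_dom /edge_lab /=; last exact: edge_span_fwd.
rewrite grpR_rev // invgK; apply: edge_spanM; exact: edge_span_fwd.
Qed.

(** Along a path from [x] to [(g h)^-1 x] through [g^-1 x], the differences
    telescope: [g h - 1 = g (h - 1) + (g - 1)]. *)
Lemma word_span w :
  exists N, edge_span N (chiR (word_dom w) * (grpR (word_lab w) - 1)).
Proof.
elim: w => [|e w [N IH]] /=.
  by exists 0%N; rewrite subrr mulr0; exact: edge_span0.
exists (maxn N e.1.+1).
have me := measurable_edge_dom e; have mw := measurable_word_dom w.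
have mg := measurable_gset alpha (edge_lab e) mw.
rewrite setIC -chiRM //.
have -> : chiR (gset (edge_lab e) (word_dom w)) * chiR (edge_dom e) *
      (grpR (edge_lab e * word_lab w)%g - 1) =
    chiR (edge_dom e) * grpR (edge_lab e) *
      (chiR (word_dom w) * (grpR (word_lab w) - 1)) +
    chiR (gset (edge_lab e) (word_dom w)) *
      (chiR (edge_dom e) * (grpR (edge_lab e) - 1)).
  rewrite -grpRM mulrA -(mulrA (chiR _) (grpR _) (chiR _)) grpR_chiR // mulrA.
  rewrite !chiRM // (setIC (gset _ _)) !mulrA !chiRM // (setIC (gset _ _)).
  by rewrite !mulrBr !mulr1 !mulrA subrKA.
apply: edge_spanD; apply: edge_spanM.
  by apply: edge_span_le IH; rewrite leq_maxl.
by apply: edge_span_le (edge_span_edge e); rewrite leq_maxr.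
Qed.

Lemma edge_spanU N g A B : measurable A -> measurable B ->
  edge_span N (chiR A * (grpR g - 1)) -> edge_span N (chiR B * (grpR g - 1)) ->
  edge_span N (chiR (A `|` B) * (grpR g - 1)).
Proof.
move=> mA mB sA sB; have mBA := measurableD mB mA.
have -> : chiR (A `|` B) = chiR A + chiR (B `\` A) * chiR B.
  rewrite (chiR_idem alpha mBA mB) // -chiRD //.
    by rewrite setDE setUIr setUv setIT.
  by rewrite setDE setICA setICr setI0.
by rewrite mulrDl -mulrA; apply: edge_spanD => //; exact: edge_spanM.
Qed.

Definition word_enum (k : nat) : seq (nat * bool) :=
  odflt [::] (choice.unpickle k).

Lemma word_enum_surj w : exists k, word_enum k = w.
Proof. by exists (choice.pickle w); rewrite /word_enum choice.pickleK. Qed.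

Fixpoint reach (s : G) (k : nat) : set X :=
  if k is k'.+1 then reach s k' `|`
    (if word_lab (word_enum k') == s then word_dom (word_enum k') else set0)
  else set0.

Lemma measurable_reach s k : measurable (reach s k).
Proof.
elim: k => //= k IH; apply: measurableU => //.
case: ifP => // _; exact: measurable_word_dom.
Qed.

Lemma reach_span s k : exists N, edge_span N (chiR (reach s k) * (grpR s - 1)).
Proof.
elim: k => [|k [N IH]] /=.
  by exists 0%N; rewrite chiR_set0 mul0r; exact: edge_span0.
case: eqP => [ws|_]; last by exists N; rewrite setU0.
have [M wM] := word_span (word_enum k); exists (maxn N M); apply: edge_spanU.
- exact: measurable_reach.
- exact: measurable_word_dom.
- by apply: edge_span_le IH; rewrite leq_maxl.
- by rewrite -ws; apply: edge_span_le wM; rewrite leq_maxr.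
Qed.

Lemma reach_word w : exists k, word_dom w `<=` reach (word_lab w) k.
Proof.
have [k <-] := word_enum_surj w.
by exists k.+1 => x /=; rewrite eqxx; right.
Qed.

Lemma reach_mono s : nondecreasing_seq (reach s).
Proof.
apply/nondecreasing_seqP => k; apply/subsetPset => x; by left.
Qed.


Variable A0 : set X.
Hypothesis mA0 : measurable A0.

(** The set reached from [A0] along the oriented edges of the list, the last one
    first.  Points that have already been reached are taken out of the new
    part, so that each point is hung on one edge only. *)
Fixpoint grow (w : seq (nat * bool)) : set X :=
  if w is e :: w' then
    grow w' `|` ((edge_dom e `&` gset (edge_lab e) (grow w')) `\` grow w')
  else A0.

Lemma measurable_grow w : measurable (grow w).
Proof.
elim: w => //= e w IH; apply: measurableU => //; apply: measurableD => //.
apply: measurableI; first exact: measurable_edge_dom.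
exact: measurable_gset.
Qed.

Lemma grow_cat w v x : word_dom w x -> grow v (alpha (word_lab w)^-1%g x) ->
  grow (w ++ v) x.
Proof.
elim: w x => [|e w IH] x /=; first by rewrite invg1 sact1.
move=> [ex wx]; rewrite invgM sactM => vx.
have [|nx] := pselect (grow (w ++ v) x); first by left.
by right; split => //; split => //; exact: IH.
Qed.

Lemma grow_base w : A0 `<=` grow w.
Proof. by elim: w => // e w IH x /IH; left. Qed.

Lemma grow_sub w v : grow v `<=` grow (w ++ v).
Proof. by elim: w => // e w IH x /IH; left. Qed.

(** A spanning forest of [U] rooted in [A0].  The element [p] sends a point of
    [U] to the root of its tree, and [B n] is the set of those [x] in [E n]
    whose edge belongs to the forest.  The measure equation counts the edges:
    each point of [U] outside [A0] hangs on exactly one of them. *)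
Definition forest_retraction (U : set X) (p : RR) (B : nat -> set X) : Prop :=
  [/\ chiR U * p = p, p *: (one : LL) = chi mu U,
      forall n, [/\ measurable (B n), B n `<=` E n, B n `<=` U &
                    B n `<=` gset (gam n) U],
      forall n, chiR (B n) * (grpR (gam n) - 1) * p = 0 &
      exists N0, forall N, (N0 <= N)%N ->
        (\sum_(n < N) mu (B n) + mu A0 = mu U)%E].

Lemma forest_retraction_base : forest_retraction A0 (chiR A0) (fun=> set0).
Proof.
split.
- by rewrite chiR_idem.
- by rewrite chiR_scale mulr1.
- by move=> n; split.
- by move=> n; rewrite chiR_set0 !mul0r.
- by exists 0%N => N _; rewrite big1 ?add0e // => i _; rewrite measure0.
Qed.

Lemma forest_retraction_step U p (B : nat -> set X) e :
  measurable U -> forest_retraction U p B ->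
  exists p' (B' : nat -> set X), forest_retraction
    (U `|` ((edge_dom e `&` gset (edge_lab e) U) `\` U)) p' B'.
Proof.
move=> mU [Up p1 PB Bp [N0 sB]].
set D := _ `\` U; set g := edge_lab e.
have mge := measurable_edge_dom e.
have mgU := measurable_gset alpha g mU.
have mD : measurable D by apply: measurableD => //; exact: measurableI.
have DU : D `&` U = set0 by rewrite /D setDE -setIA setICl setI0.
have DgU : D `<=` gset g U by move=> x [[]].
have De : D `<=` edge_dom e by move=> x [[]].
have [Up' p1' Dp' keep] := attach_to_forest mU mD DU DgU Up p1.
set p' := p + _ in Up' p1' Dp' keep; clearbody p'; set n := e.1.
(* The part of [E n] used by the new points: [D] itself, or its translate by
   [gam n] when the edge is traversed backwards. *)
have [Q [mQ QE QU QgU [Qp' muQ QB]]] : exists Q : set X,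
    [/\ measurable Q, Q `<=` E n, Q `<=` U `|` D,
        Q `<=` gset (gam n) (U `|` D) &
      [/\ chiR Q * (grpR (gam n) - 1) * p' = 0, mu Q = mu D &
          Q `&` B n = set0]].
  have [_ _ BU BgU] := PB n.
  move: De DgU Dp'; rewrite /g /n /edge_dom /edge_lab; case: e.2 => De DgU Dp'.
    exists (gset (gam e.1) D); have mgD := measurable_gset alpha (gam e.1) mD.
    split; first exact: mgD.
    - by move=> x /De; rewrite /gset /= invgK -sactM mulgV sact1.
    - by move=> x /DgU; rewrite /gset /= invgK -sactM mulgV sact1; left.
    - by move=> x Dx; right.
    - split; [|exact: mu_gset|].
        rewrite (grpR_rev (gam e.1) mD) !mulNr -(mulrA (grpR _)) Dp'.
        by rewrite mulr0 oppr0.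
      rewrite -subset0 => x [Dx /BgU Ux].
      have : (D `&` U) (alpha (gam e.1)^-1%g x) by [].
      by rewrite DU.
  exists D; split; [exact: mD|exact: De| | |].
  - by move=> x Dx; right.
  - by move=> x /DgU; left.
  - split; [exact: Dp'|exact: erefl|].
    by rewrite -subset0 -DU => x [Dx /BU].
have BQ : B n `&` Q = set0 by rewrite setIC.
exists p', (fun m => if m == n then B m `|` Q else B m).
split; [exact: Up'|exact: p1'| | |].
- move=> m; have [mB BE BU BgU] := PB m; case: eqP => [mn|_].
    rewrite mn in mB BE BU BgU *; split.
    + exact: measurableU.
    + by move=> x [/BE|/QE].
    + by move=> x [/BU|/QU]; [left|].
    + by move=> x [/BgU|/QgU]; [left|].
  by split => // x; [move/BU|move/BgU]; left.
- move=> m; have [mB BE BU BgU] := PB m.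
  have Bm := keep _ _ mB BU BgU (Bp m).
  case: eqP => [mn|//]; rewrite mn in mB BE BU BgU Bm *.
  rewrite (chiRD alpha mB mQ BQ) 2!mulrDl Qp' addr0.
  exact: Bm.
- exists (maxn N0 n.+1) => N; rewrite geq_max => /andP[N0N nN].
  have [mB _ _ _] := PB n.
  rewrite measureU //; last by rewrite setIC.
  rewrite -[X in (_ = X + _)%E](sB N N0N).
  rewrite (bigD1 (Ordinal nN)) //= eqxx measureU //.
  rewrite [in RHS](bigD1 (Ordinal nN)) //= muQ.
  rewrite (eq_bigr (fun i : 'I_N => mu (B i))); last first.
    by move=> i; rewrite -val_eqE /= => /negPf ->.
  by rewrite -!addeA; congr (_ + _)%E; rewrite addeC -addeA.
Qed.

Lemma forest_retraction_grow w :
  exists p (B : nat -> set X), forest_retraction (grow w) p B.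
Proof.
elim: w => [|e w [p [B pB]]] /=.
  by exists (chiR A0), (fun=> set0); exact: forest_retraction_base.
exact: forest_retraction_step (measurable_grow w) pB.
Qed.

End Forest.

(** * Exhaustions and separating sets *)

Section Measure.
Context (R : realType) (d : measure_display) (X : measurableType d).
Context (mu : probability X R).

Lemma exhaust (F : nat -> set X) (e : R) :
  (forall k, measurable (F k)) -> nondecreasing_seq F ->
  {ae mu, forall x, exists k, F k x} -> 0 < e ->
  exists k, (mu (~` F k) <= e%:E)%E.
Proof.
move=> mF ndF aeF e0.
pose H k := ~` F k.
have mH k : measurable (H k) by exact: measurableC.
have mcap : measurable (\bigcap_k H k) by exact: bigcap_measurable.
have cap0 : mu (\bigcap_k H k) = 0%E.
  have [N [mN N0 sN]] := aeF.
  apply/eqP; rewrite eq_le measure_ge0 andbT -N0.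
  apply: le_measure; rewrite ?inE //.
  by apply: subset_trans sN => x Hx /= [k]; exact: Hx.
have /fine_cvgP[_] : mu \o H @ \oo --> (0 : R)%:E.
  have -> : (0 : R)%:E = mu (\bigcap_k H k) by rewrite cap0.
  apply: nonincreasing_cvg_mu => //.
    by rewrite (le_lt_trans (probability_le1 mu (mH 0%N))) // ltry.
  by move=> m n mn; apply/subsetPset/subsetC/subsetPset; exact: ndF.
move=> /cvgrPdist_le /(_ _ e0)[k _ /(_ k (leqnn k))].
rewrite sub0r normrN /= => ke.
exists k; rewrite -[leLHS]fineK; last by apply: fin_num_measure; exact: mH.
by rewrite lee_fin (le_trans (ler_norm _)).
Qed.

(** The sets are the preimages of the balls of radius [1 / (n + 1)] centred at
    the points of a countable dense set; interiors are taken so that they are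
    visibly open. *)
Lemma standard_borel_separating : standard_borel R X ->
  exists B : nat -> set X, (forall k, measurable (B k)) /\
    forall x y, x <> y -> exists k, B k x /\ ~ B k y.
Proof.
move=> [T [h [_ [D /countable_injP[f finj] dD] hbij mX]]].
pose O (kn : nat * nat) : set T :=
  \bigcup_(c in [set c | D c /\ f c = kn.1]) interior (ball c (kn.2.+1%:R^-1)).
have oO kn : open (O kn).
  by apply: bigcup_open => c _; exact: open_interior.
pose B k :=
  if @choice.pickle_inv (nat * nat)%type k is Some kn then h @^-1` O kn
  else set0.
exists B; split => [k|x y xy].
  rewrite /B; case: choice.pickle_inv => // kn; apply/mX; exists (O kn) => //.
  by apply: sub_sigma_algebra; exact: oO.
have hxy : h x != h y by apply/eqP => hE; apply: xy; exact: (bij_inj hbij).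
pose e := mdist (h x) (h y); have e0 : 0 < e by rewrite mdist_gt0.
have [n] := ltr_add_invr (divr_gt0 e0 (ltr0n R 2)); rewrite add0r => ne.
have r0 : 0 < n.+1%:R^-1 / 2 :> R by rewrite divr_gt0.
have [c [/= xc Dc]] : (interior (ball (h x) (n.+1%:R^-1 / 2)) `&` D) !=set0.
  apply: dD; last exact: open_interior.
  by exists (h x); exact: nbhsx_ballx.
move/interior_subset/ball_sym : xc => cx.
exists (choice.pickle (f c, n)); rewrite /B choice.pickleK_inv; split.
  exists c => //=; apply: filterS (nbhsx_ballx (h x) _ r0) => z.
  exact: ball_split.
move=> [c' [Dc' /= fc]] /interior_subset /ball_sym c'y.
have {}fc : c' = c by apply: finj; rewrite ?inE.
rewrite fc in c'y; have cx' : ball (h x) (n.+1%:R^-1) c.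
  apply: ball_sym; apply: le_ball cx.
  by rewrite ler_piMr ?invr_ge0 // invf_le1 ?ler1n.
have := ball_triangle cx' (ball_sym c'y).
rewrite ballEmdist /= ltNge => /negP; apply.
by rewrite -/e [leRHS]splitr; apply: lerD; exact: ltW.
Qed.

End Measure.

(** * Small sets meeting every orbit *)

Section Dynamics.
Context (R : realType) (d : measure_display) (X : measurableType d).
Context (mu : probability X R) (G : groupType).
Variable alpha : standard_action mu G.
Local Notation gset := (gset alpha).

Lemma group_enum : exists gam : nat -> G, forall g, exists n, gam n = g.
Proof.
have /countable_injP[f finj] := sact_countable alpha.
exists (fun n => xget 1%g [set g | f g = n]) => g; exists (f g).
case: xgetP => [h _ /= hg|/(_ g) /=]; last by case.
by apply: finj; rewrite ?inE.
Qed.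

(** Two maps differ at [x] exactly if some set of the separating family contains
    one value and not the other. *)
Lemma measurable_coincide (B : nat -> set X) (D : set X) (f h : X -> X) :
  (forall k, measurable (B k)) ->
  (forall x y, x <> y -> exists k, B k x /\ ~ B k y) ->
  measurable D -> measurable_fun D f -> measurable_fun D h ->
  measurable (D `&` [set x | f x = h x]).
Proof.
move=> mB sB mD mf mh.
have -> : D `&` [set x | f x = h x] =
    D `\` \bigcup_k ((D `&` f @^-1` B k) `\` (D `&` h @^-1` B k)).
  apply/seteqP; split => x [Dx fh]; split => //.
    by move=> [k _ [[_ fB] hB]]; apply: hB; split => //=; rewrite -fh.
  apply/eqP/negPn/negP => /eqP /sB[k [fB hB]]; apply: fh; exists k => //.
  by split => // -[].
apply: measurableD => //; apply: bigcup_measurable => k _.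
by apply: measurableD; [apply: mf|apply: mh].
Qed.

Lemma measurable_saturation A : measurable A ->
  measurable (\bigcup_(g in [set: G]) gset g A).
Proof.
move=> mA; have [gam gamS] := group_enum.
have -> : \bigcup_(g in [set: G]) gset g A = \bigcup_n gset (gam n) A.
  apply/seteqP; split => x [g _ xg]; last by exists (gam g).
  by have [n gn] := gamS g; exists n => //; rewrite gn.
by apply: bigcup_measurable => n _; exact: measurable_gset.
Qed.

(** The translates of [W] are disjoint up to null sets and have the same
    measure, and there are infinitely many of them. *)
Lemma wandering_null (W : set X) : infinite_set [set: G] -> measurable W ->
  (forall x g, W x -> W (alpha g x) -> alpha g x = x) -> mu W = 0%E.
Proof.
move=> infG mW W1.
have [N [mN N0 sN]] := sact_free alpha.
pose V := W `\` N; have mV : measurable V by exact: measurableD.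
have VW : mu W = mu V.
  apply/eqP; rewrite eq_le; apply/andP; split.
    rewrite -[leRHS]adde0 -N0 (le_trans _ (measureU2 _ _ _)) //.
    apply: le_measure; rewrite ?inE //; first exact: measurableU.
    by move=> x Wx; have [|] := pselect (N x); [right|left].
  by apply: le_measure; rewrite ?inE //; exact: subDsetl.
have [gam gam_inj] : exists gam : nat -> G, injective gam.
  have /infiniteP/card_leP[f] := infG.
  pose i (n : nat) : set_type [set: nat] := exist _ n (mem_set (I : setT n)).
  exists (fun n => val (f (i n))) => m n /val_inj mn.
  have : i m = i n by apply: (@inj _ _ _ f); rewrite ?inE.
  by move/(congr1 val).
have dis : trivIset setT (fun n => gset (gam n) V).
  apply/trivIsetP => m n _ _ mn; rewrite -subset0 => x [/= [Wm Nm] [Wn Nn]].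
  have gmn : alpha (gam n)^-1%g x =
      alpha ((gam n)^-1 * gam m)%g (alpha (gam m)^-1%g x).
    by rewrite -sactM -mulgA mulgV mulg1.
  have fix1 : alpha ((gam n)^-1 * gam m)%g (alpha (gam m)^-1%g x) =
      alpha (gam m)^-1%g x.
    by apply: W1 => //; rewrite -gmn.
  apply: Nm; apply: sN => /= /(_ _ fix1) /(congr1 (fun h => gam n * h)%g).
  rewrite mulgA mulgV mul1g mulg1 => /gam_inj nm.
  by rewrite nm eqxx in mn.
rewrite VW; apply/eqP; rewrite eq_le measure_ge0 andbT leNgt; apply/negP => V0.
have Vfin : mu V \is a fin_num by exact: fin_num_measure.
have bound n : (n%:R * fine (mu V) <= 1 :> R).
  rewrite -lee_fin EFinM fineK //.
  have -> : (n%:R%:E * mu V = mu (\big[setU/set0]_(i < n) gset (gam i) V))%E.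
    rewrite (@measure_bigsetU _ _ _ mu (fun i => gset (gam i) V)) //.
    - rewrite (eq_bigr (fun=> (fine (mu V))%:E)) => [|i _]; last first.
        by rewrite fineK //; exact: mu_gset.
      by rewrite -(fineK Vfin) -EFinM sumEFin sumr_const card_ord mulr_natl.
    - by move=> i; exact: measurable_gset.
  apply: probability_le1; apply: bigsetU_measurable => i _.
  exact: measurable_gset.
have Vpos : 0 < fine (mu V) by rewrite fine_gt0 // V0 ltey_eq Vfin.
have := archi_boundP (ltW (divr_gt0 (@ltr01 R) Vpos)).
by rewrite ltr_pdivrMr // ltNge bound.
Qed.

(** The set is thinned out step by step: in step [k], an orbit that still has a
    point in [B k] keeps only its points in [B k], and the other orbits are left
    alone.  No orbit is ever emptied.  Since the sets [B k] separate points, the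
    intersection of all steps has at most one point in each orbit, hence is
    null, so that the measures tend to zero. *)
Lemma small_section (e : R) : infinite_set [set: G] -> 0 < e ->
  exists A : set X, [/\ measurable A, (mu A <= e%:E)%E &
    forall x, exists g, A (alpha g x)].
Proof.
move=> infG e0.
have [B [mB sB]] := standard_borel_separating (sact_borel alpha).
pose sat A := \bigcup_(g in [set: G]) gset g A.
pose A := fix A k :=
  if k is k'.+1 then (A k' `&` B k') `|` (A k' `\` sat (A k' `&` B k'))
  else setT.
have mA k : measurable (A k).
  elim: k => //= k IH; have mAB := measurableI _ _ IH (mB k).
  apply: measurableU => //; apply: measurableD => //.
  exact: measurable_saturation.
have AS k x : A k.+1 x -> A k x by move=> [[]|[]].
have meet k x : exists g, A k (alpha g x).
  elim: k => [|k [g Ag]]; first by exists 1%g.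
  have [[h _ Ah]|nsat] := pselect (sat (A k `&` B k) (alpha g x)).
    by exists (h^-1 * g)%g; left; rewrite sactM.
  by exists g; right.
have niA : nonincreasing_seq A.
  by apply/nonincreasing_seqP => k; apply/subsetPset => x; exact: AS.
have [k Ak] : exists k, (mu (~` (~` A k)) <= e%:E)%E.
  apply: (@exhaust _ _ _ mu (fun k => ~` A k)) => //.
  - by move=> k; exact: measurableC.
  - by move=> m n mn; apply/subsetPset/subsetC/subsetPset; exact: niA.
  exists (\bigcap_k A k); split; first exact: bigcap_measurable.
    apply: wandering_null => //; first exact: bigcap_measurable.
    move=> x g Ax Agx; apply/eqP/negPn/negP => /eqP /sB[k [Bg Bx]].
    have [[_ //]|[_ nsat]] := Ax k.+1 I.
    apply: nsat; exists g^-1%g => //; rewrite /gset /= invgK; split => //.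
    exact: Agx.
  move=> x /= nx k _; apply: contrapT => nA; apply: nx; by exists k.
rewrite setCK in Ak; exists (A k); split => //; exact: meet.
Qed.

End Dynamics.

(** * The edges of a graphing *)

Section Edges.
Context (R : realType) (d : measure_display) (X : measurableType d).
Context (mu : probability X R) (G : groupType).
Variable alpha : standard_action mu G.
Variable Phi : graphing alpha.

(** The domain of each partial isomorphism is partitioned according to the group
    element by which it acts, the first one in a fixed enumeration where there
    are several. *)
Lemma graphing_edges : exists (E : nat -> set X) (gam : nat -> G),
  [/\ forall n, measurable (E n),
      forall N, (\sum_(n < N) mu (E n) <= graphing_cost Phi)%E &
      forall i u, gr_dom Phi i u ->
        exists n, E n u /\ gr_map Phi i u = alpha (gam n)^-1%g u].
Proof.
have [gam gamS] := group_enum alpha.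
have [B [mB sB]] := standard_borel_separating (sact_borel alpha).
pose same i j :=
  gr_dom Phi i `&` [set x | gr_map Phi i x = alpha (gam j)^-1%g x].
have mdom i : measurable (gr_dom Phi i) by have [] := gr_iso Phi i.
have msame i j : measurable (same i j).
  apply: (measurable_coincide mB sB) => //; first by have [] := gr_iso Phi i.
  by apply: measurable_funTS; exact: sact_measurable.
pose piece (ij : nat * nat) :=
  same ij.1 ij.2 `\` \bigcup_(j in `I_ij.2) same ij.1 j.
have mpiece ij : measurable (piece ij).
  by apply: measurableD => //; apply: bigcup_measurable.
(* [pickle_inv] decodes at most one number to a given pair, which [unpickle]
   need not do; otherwise a piece could be counted twice. *)
pose dec n := @choice.pickle_inv (nat * nat)%type n.
pose E n := if dec n is Some ij then piece ij else set0.
have mE n : measurable (E n) by rewrite /E; case: (dec n).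
pose fst_idx n := if dec n is Some ij then ij.1 else 0%N.
have Edom n : E n `<=` gr_dom Phi (fst_idx n).
  by rewrite /E /fst_idx; case: (dec n) => [ij|] // x [[]].
have Edis m n : fst_idx m = fst_idx n -> E m `&` E n !=set0 -> m = n.
  rewrite /fst_idx /E; case em: (dec m) => [[i j]|] /=; last by move=> _ [x []].
  case en: (dec n) => [[i' j']|] /=; last by move=> _ [x []].
  move=> ii; rewrite -{i'}ii in en *; move=> [x [[xj nj] [xj' nj']]].
  have jj : j = j'.
    case: (ltngtP j j') => // jj; exfalso.
      by apply: nj'; exists j.
    by apply: nj; exists j'.
  rewrite -jj in en.
  have pm := choice.pickle_invK m : oapp choice.pickle m (dec m) = m.
  have pn := choice.pickle_invK n : oapp choice.pickle n (dec n) = n.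
  by rewrite -pm -pn em en.
exists E, (fun n => gam (if dec n is Some ij then ij.2 else 0%N)); split => //.
- move=> N; pose K := (\max_(n < N) fst_idx n).+1.
  have fK (n : 'I_N) : (fst_idx n < K)%N by rewrite ltnS leq_bigmax.
  rewrite (partition_big (fun n : 'I_N => Ordinal (fK n)) predT) //=.
  apply: (@le_trans _ _ (\sum_(i < K) mu (gr_dom Phi i))%E); last first.
    rewrite -(big_mkord predT (fun i => mu (gr_dom Phi i))).
    exact: nneseries_lim_ge.
  apply: lee_sum => i _; rewrite -measure_bigsetU_ord_cond //.
    apply: le_measure; rewrite ?inE //; first exact: bigsetU_measurable.
    rewrite -bigcup_seq_cond.
    by move=> x [n /= /andP[_ /eqP <-]] /Edom.
  move=> m n /eqP im /eqP in_ mn; apply: val_inj; apply: Edis => //=.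
  by move: im; rewrite -in_ => /(congr1 val).
- move=> i u iu; have [g ug] := gr_orbit iu.
  have [j0 j0g] := gamS g^-1%g.
  have exj : exists j, `[< same i j u >].
    by exists j0; apply/asboolP; split => //=; rewrite j0g invgK.
  case: (ex_minnP exj) => j /asboolP sj minj.
  exists (choice.pickle (i, j)); rewrite /E /dec choice.pickleK_inv.
  split; last by case: sj.
  split => // -[k /= kj sk].
  by have := minj k (asboolT sk); rewrite leqNgt kj.
Qed.

Variables (E : nat -> set X) (gam : nat -> G).
Hypothesis mE : forall n, measurable (E n).
Hypothesis edgesP : forall i u, gr_dom Phi i u ->
  exists n, E n u /\ gr_map Phi i u = alpha (gam n)^-1%g u.
Local Notation word_dom := (word_dom alpha E gam).
Local Notation word_lab := (word_lab gam).

(** A path obtained from the generation property ends at [g^-1 x], and by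
    freeness its label is then [g]. *)
Lemma graphing_words :
  {ae mu, forall x, forall g, exists w, word_dom w x /\ word_lab w = g}.
Proof.
apply: filterS2 (gr_generates Phi) (sact_free alpha) => x gen free g.
have : clos_refl_sym_trans X
    (fun u v => exists2 i, gr_dom Phi i u & v = gr_map Phi i u)
    x (alpha g^-1%g x) by apply/gen; exists g^-1%g.
have words u v : clos_refl_sym_trans X
    (fun u v => exists2 i, gr_dom Phi i u & v = gr_map Phi i u) u v ->
    exists w, word_dom w u /\ v = alpha (word_lab w)^-1%g u.
  elim=> {u v} [u v [i iu ->]|u|u v _ [w [wu ->]]|
      u v z _ [w [wu ->]] _ [w' [wv ->]]].
  - have [n [nu ->]] := edgesP iu.
    exists [:: (n, false)]; rewrite /= mulg1; split => //.
  - by exists [::]; rewrite /= invg1 sact1.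
  - have [w' [vd vl]] := word_rev wu; exists w'; split => //.
    by rewrite vl invgK -sactM mulgV sact1.
  - exists (w ++ w'); rewrite word_lab_cat invgM sactM; split => //.
    exact: word_dom_cat.
move=> /words[w [wx gw]]; exists w; split => //.
have : alpha (g * (word_lab w)^-1)%g x = x.
  by rewrite sactM -gw -sactM mulgV sact1.
move=> /free /(congr1 (fun h => h * word_lab w)%g).
by rewrite mul1g -mulgA mulVg mulg1 => <-.
Qed.

Lemma reach_large s (e : R) : 0 < e ->
  exists k, (mu (~` reach alpha E gam s k) <= e%:E)%E.
Proof.
move=> e0; apply: exhaust => //.
- by move=> k; exact: measurable_reach.
- exact: reach_mono.
- apply: filterS graphing_words => x /(_ s)[w [wx ws]].
  have [k wk] := reach_word alpha E gam w.
  by exists k; rewrite -ws; exact: wk.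
Qed.

(** Prepending all paths one after the other to the list gives an increasing
    sequence of grown sets.  The start of a path that ends in [A] is reached
    once this path has been prepended, since every grown set contains [A]. *)
Lemma grow_large A (e : R) :
  measurable A -> (forall x, exists g, A (alpha g x)) ->
  0 < e -> exists w, (mu (~` grow alpha E gam A w) <= e%:E)%E.
Proof.
move=> mA meetA e0.
pose long := fix long k :=
  if k is k'.+1 then word_enum k' ++ long k' else [::].
have [k Hk] : exists k, (mu (~` grow alpha E gam A (long k)) <= e%:E)%E.
  apply: (exhaust (F := fun k => grow alpha E gam A (long k))) => //.
  - by move=> k; exact: measurable_grow.
  - apply/nondecreasing_seqP => k; apply/subsetPset; exact: grow_sub.
  - apply: filterS graphing_words => x xw.
    have [g Ag] := meetA x; have [w [wx wg]] := xw g^-1%g.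
    have [k kw] := word_enum_surj w; exists k.+1 => /=; rewrite kw.
    apply: grow_cat => //; rewrite wg invgK; exact: grow_base.
by exists (long k).
Qed.

End Edges.

(** * Marked complexes concentrated in degrees at most two *)

Section DsumMaps.
Variables (S : nzRingType) (I : finType) (e : I -> S).

Definition dsum_lin (V : lmodType S) (v : I -> V) (f : dsum_ideal e) : V :=
  \sum_i (dsum_fun f i : S) *: v i.

Lemma dsum_lin_is_linear (V : lmodType S) (v : I -> V) : linear (@dsum_lin V v).
Proof.
move=> a f h; rewrite /dsum_lin scaler_sumr -big_split.
apply: eq_bigr => i _ /=.
by rewrite !ffunE scalerDl scalerA.
Qed.
HB.instance Definition _ (V : lmodType S) (v : I -> V) :=
  GRing.isLinear.Build S (dsum_ideal e) V *:%R (@dsum_lin V v)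
    (dsum_lin_is_linear v).

Fact dsum_elt_subproof (a : I -> S) :
  [ffun i => a i * e i : S^o] \in dsum_pred e.
Proof. by apply/asboolP => i; exists (a i); rewrite ffunE. Qed.
Definition dsum_elt (a : I -> S) : dsum_ideal e :=
  DsumIdeal (dsum_elt_subproof a).

Lemma dsum_eltE a i : dsum_elt a i = a i * e i.
Proof. by rewrite ffunE. Qed.

End DsumMaps.

Section SemilinearMaps.
Variables (T S : nzRingType) (iota : {rmorphism T -> S}).
Variables (C : lmodType T) (D : lmodType S) (n : nat).
Variables (tau : 'I_n -> {linear C -> T^o}) (v : 'I_n -> D).

Definition semilin (x : C) : D := \sum_j iota (tau j x) *: v j.

Lemma semilin_is_linear : linear_for (iota \; *:%R) semilin.
Proof.
move=> a x y; rewrite /semilin /= scaler_sumr -big_split.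
apply: eq_bigr => j _ /=.
by rewrite linearP rmorphD rmorphM scalerDl scalerA.
Qed.
HB.instance Definition _ :=
  GRing.isLinear.Build T C D (iota \; *:%R) semilin semilin_is_linear.
End SemilinearMaps.

Section Complex.
Context (R : realType) (d : measure_display) (X : measurableType d).
Context (mu : probability X R) (G : groupType).
Variable alpha : standard_action mu G.
Local Notation RR := (crossed (Linf_action alpha)).
Local Notation LL := (crossed_base (Linf_action alpha)).
Local Notation one := (1 : Linf mu).

Variables (I : finType) (A : I -> set X) (m : nat).
Hypothesis mA : forall i, measurable (A i).

(** The complex has the term [<X>] in degree 0, the sum of the [<A i>] in degree
    1 and the free module of rank [m] in degree 2.  The generator of [<A i>] is
    mapped to [chiR (A i) * V i], and those of degree 2 are mapped to the
    cycles [w l]. *)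
Definition cplx_index (k : nat) : finType :=
  match k with 0 => unit | 1 => I | 2 => 'I_m | _ => void end.
Definition cplx_set k : cplx_index k -> set X :=
  match k with 1 => A | _ => fun=> setT end.
Lemma measurable_cplx_set k (i : cplx_index k) : measurable (cplx_set i).
Proof. by case: k i => [|[|k]] i //=; exact: measurableT. Qed.

Definition cplx_obj k : lmodType RR := dsum_ideal (fun i : cplx_index k =>
  single (Linf_action alpha) 1%g (Linf_chi mu (measurable_cplx_set i))).

Variable V : I -> RR.
Variable w : 'I_m -> cplx_obj 1.

Definition cplx_elt k (a : cplx_index k -> RR) : cplx_obj k := dsum_elt _ a.

Definition cplx_image k : cplx_index k.+1 -> cplx_obj k :=
  match k with
  | 0 => fun i => cplx_elt (k := 0%N) (fun=> V i)
  | 1 => w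
  | _ => fun=> 0
  end.

Definition cplx_diff k : {linear cplx_obj k.+1 -> cplx_obj k} :=
  dsum_lin (@cplx_image k).

Hypothesis V0 : forall i, V i *: (one : LL) = 0.
Hypothesis w0 : forall l, cplx_diff 0 (w l) = 0.

Lemma cplx_diff_comp k x : cplx_diff k (cplx_diff k.+1 x) = 0.
Proof.
rewrite [cplx_diff k.+1 x]/(dsum_lin _ _) /dsum_lin linear_sum big1 // => i _.
rewrite linearZ /=; case: k i x => [|k] i x /=; first by rewrite w0 scaler0.
by rewrite linear0 scaler0.
Qed.

Definition cplx_chain : chain_complex RR := ChainComplex cplx_diff_comp.

Definition cplx_augm : {linear cplx_obj 0 -> LL} := dsum_lin (fun=> one : LL).

Lemma cplx_elt0E (a : RR) : cplx_elt (k := 0%N) (fun=> a) tt = a.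
Proof. by rewrite dsum_eltE -chiE chi_setT mulr1. Qed.

Lemma cplx_obj0_inj (x y : cplx_obj 0) : x tt = y tt -> x = y.
Proof. by move=> xy; apply/val_inj/ffunP => -[]. Qed.

Lemma cplx_diff0E (x : cplx_obj 1) : cplx_diff 0 x tt = \sum_(i : I) x i * V i.
Proof.
rewrite -[cplx_diff 0 x tt]/(val (\sum_(i : I)
  (x i : RR) *: cplx_elt (k := 0%N) (fun=> V i)) tt).
rewrite raddf_sum sum_ffunE; apply: eq_bigr => i _.
by rewrite ffunE cplx_elt0E.
Qed.

Lemma cplx_diff1_unit l :
  cplx_diff 1 (cplx_elt (k := 2%N) (fun i => (i == l)%:R)) = w l.
Proof.
rewrite [LHS](bigD1 l) //= dsum_eltE -chiE chi_setT eqxx mulr1 scale1r.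
rewrite big1 ?addr0 // => i /negPf il.
by rewrite dsum_eltE il mul0r scale0r.
Qed.

Lemma cplx_augmE (a : RR) :
  cplx_augm (cplx_elt (k := 0%N) (fun=> a)) = a *: (one : LL).
Proof.
rewrite [LHS](big_pred1 tt); first by rewrite cplx_elt0E.
by case.
Qed.

Lemma cplx_augm_surj b : exists x, cplx_augm x = b.
Proof.
exists (cplx_elt (k := 0%N)
  (fun=> single (Linf_action alpha) 1%g (b : Linf mu))).
by rewrite cplx_augmE single_scale rmorph1 mulr1.
Qed.

Lemma cplx_augm_diff x : cplx_augm (cplx_diff 0 x) = 0.
Proof.
rewrite [cplx_diff 0 x]/(dsum_lin _ _) /dsum_lin linear_sum big1 // => i _.
by rewrite linearZ /= cplx_augmE V0 scaler0.
Qed.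

Definition cplx_augmented : augmented_complex LL :=
  @AugmentedComplex _ LL cplx_chain cplx_augm cplx_augm_surj cplx_augm_diff.

Definition cplx_marking k : marking (cplx_augmented k) :=
  @Marking _ _ _ _ _ _ (cplx_augmented k) (cplx_index k) (@cplx_set k)
    (@measurable_cplx_set k) idfun (Bijective (fun=> erefl) (fun=> erefl)).

Definition cplx_marked : marked_complex alpha := MarkedComplex cplx_marking.

End Complex.

(** * Embedding a free resolution *)

Section GroupRingFacts.
Variables (G : groupType) (A : comNzRingType) (rho : ring_action G A).
Local Notation ZG := (crossed (trivial_action G)).
Local Notation ZZ := (crossed_base (trivial_action G)).
Local Notation incl := (group_ring_incl rho).

Lemma incl_scale1 (z : ZG) :
  incl z *: ((1 : A) : crossed_base rho) =
    ((z *: ((1 : int) : ZZ) : int)%:~R : A) :> A.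
Proof.
move: z; apply: crossed_ext_eq => [x y|x y|g n].
- by rewrite rmorphB scalerBl.
- by rewrite scalerBl -rmorphB.
- by rewrite group_ring_incl_single !single_scale !rmorph1 !mulr1.
Qed.

(** Subtract the sum of the coefficients, which vanishes, times the identity. *)
Lemma incl_augm0 (z : ZG) : z *: ((1 : int) : ZZ) = 0 ->
  incl z =
    \sum_(g <- finsupp z) single rho 1%g (z g)%:~R * (single rho g 1 - 1).
Proof.
move=> z0.
under eq_bigr do rewrite mulrBr mulr1 single_mul mul1g rmorph1 mulr1.
rewrite sumrB -raddf_sum -rmorph_sum.
have -> : \sum_(g <- finsupp z) z g = 0 :> int.
  rewrite -[RHS]z0.
  have -> : z *: ((1 : int) : ZZ) =
    \sum_(g <- finsupp z) z g * trivial_action G g 1 :> int by [].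
  by apply: eq_bigr => g _; rewrite rmorph1 mulr1.
by rewrite rmorph0 raddf0 subr0.
Qed.

End GroupRingFacts.

Section Embedding.
Context (R : realType) (d : measure_display) (X : measurableType d).
Context (mu : probability X R) (G : groupType).
Variable alpha : standard_action mu G.
Local Notation RR := (crossed (Linf_action alpha)).
Local Notation LL := (crossed_base (Linf_action alpha)).
Local Notation one := (1 : Linf mu).
Local Notation ZG := (crossed (trivial_action G)).
Local Notation ZZ := (crossed_base (trivial_action G)).
Local Notation incl := (group_ring_incl (Linf_action alpha)).

Lemma augmentation_lift (P : augmented_complex ZZ) : projective (P 0%N) ->
  exists f : {linear P 0%N -> ZG^o},
    forall x, (f x : ZG) *: ((1 : int) : ZZ) = augm P x.
Proof.
move=> projP.
have epsL : linear (fun r : ZG^o => (r : ZG) *: ((1 : int) : ZZ)).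
  by move=> a x y; rewrite scalerDl -scalerA.
pose eps : {linear ZG^o -> ZZ} :=
  HB.pack (fun r : ZG^o => (r : ZG) *: ((1 : int) : ZZ))
  (GRing.isLinear.Build ZG ZG^o ZZ *:%R _ epsL).
apply: (projP _ _ eps (augm P)) => n.
exists (single (trivial_action G) 1%g (n : int)).
by rewrite [LHS]single_scale mulr1.
Qed.

(** The elements [z j] are the images, under a lift [P 0 -> Z G] of the
    augmentation, of the boundaries of the generators of [P 1].  In degree 0
    the chain map is this lift followed by right multiplication by [p], so in
    degree 1 it exists as soon as the [z j * p] are boundaries.  In degree 2,
    the free module on the generators [u l] of [P 2] is mapped to the images
    of their boundaries.  The [z j] depend on [P] only, so that the sets [A i]
    can be chosen after them. *)
Lemma FP2_embedding (C : free_resolution G) : type_FP G 2 ->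
  exists (n : nat) (z : 'I_n -> ZG),
  (forall j, z j *: ((1 : int) : ZZ) = 0) /\
  forall (I : finType) (A : I -> set X) (V : I -> RR) (p : RR),
    (forall i, measurable (A i)) ->
    (forall i, V i *: (one : LL) = 0) -> p *: (one : LL) = one ->
    (forall j, exists a : I -> RR,
       \sum_i a i * chiR alpha (A i) * V i = incl (z j) * p) ->
    exists2 D : marked_complex alpha, alpha_embedding 1 C D &
      marked_dim (mc_marking D 1) = (\sum_i mu (A i))%E.
Proof.
move=> [P [resP projP fgP]].
have [h0 [h1 [h2 [h0P h1P h2P]]]] := resolution_lift (@fr_free G C) resP.
have [f0 f0P] := augmentation_lift (projP 0%N).
have [n [e [s sP]]] := projective_dual_basis (projP 1%N) (fgP 1%N isT).
have [m [u [t tP]]] := projective_dual_basis (projP 2%N) (fgP 2%N isT).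
pose z j : ZG := f0 (cdiff P 0 (e j)).
exists n, z; split => [j|I A V p mA V0 p1 aP]; first by rewrite f0P augm_diff.
have /choice[a {}aP] := aP.
pose obj k := cplx_obj alpha m mA k.
pose y j : obj 1%N := cplx_elt (m := m) (k := 1%N) mA (a j).
pose d0 : obj 0%N := cplx_elt (m := m) (k := 0%N) mA (fun=> p).
pose F0 x := incl (f0 x) *: d0.
pose F1 x : obj 1%N := semilin incl s y x.
pose w l : obj 1%N := F1 (cdiff P 1 (u l)).
pose dif := cplx_diff V w.
have dify j : dif 0%N (y j) = incl (z j) *: d0.
  apply: cplx_obj0_inj; rewrite cplx_diff0E ffunE cplx_elt0E.
  rewrite -[RHS]/(incl (z j) * p) -aP.
  by apply: eq_bigr => i _; rewrite dsum_eltE -chiE.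
have F1P x : dif 0%N (F1 x) = F0 (cdiff P 0 x).
  rewrite /F1 /semilin linear_sum [in RHS](sP x) /F0 !linear_sum rmorph_sum.
  rewrite scaler_suml; apply: eq_bigr => j _.
  by rewrite linearZ /= dify !linearZ /= rmorphM scalerA.
have w0 l : dif 0%N (w l) = 0.
  by rewrite F1P (@cdiff_comp _ P) /F0 linear0 rmorph0 scale0r.
pose D := cplx_marked V0 w0.
pose g0 : {linear C 0%N -> obj 0%N | (incl \; *:%R)} :=
  semilin incl (fun _ : 'I_1 => f0 \o h0) (fun=> d0).
pose g1 : {linear C 1%N -> obj 1%N | (incl \; *:%R)} :=
  semilin incl (fun j => s j \o h1) y.
pose unit l : obj 2%N := cplx_elt (m := m) (k := 2%N) mA (fun i => (i == l)%:R).
pose g2 : {linear C 2%N -> obj 2%N | (incl \; *:%R)} :=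
  semilin incl (fun l => t l \o h2) unit.
pose g k : {linear C k -> D k | (incl \; *:%R)} :=
  match k with
  | 0 => g0 | 1 => g1 | 2 => g2
  | k => semilin incl (fun _ : 'I_0 => (\0 : {linear C k -> ZG^o})) (fun=> 0)
  end.
have g0E x : g0 x = F0 (h0 x) by rewrite [LHS]big_ord1.
have g1E x : g1 x = F1 (h1 x) by [].
have F1_sum (c : 'I_m -> ZG) (v : 'I_m -> P 1%N) :
    F1 (\sum_l c l *: v l) = \sum_l incl (c l) *: F1 (v l).
  pose F1' : {linear P 1%N -> obj 1%N | (incl \; *:%R)} := semilin incl s y.
  rewrite -[F1]/(F1' : _ -> _) linear_sum.
  by apply: eq_bigr => l _; rewrite linearZ.
exists D => //; exists g; split.
  case=> [|[|//]] _ x.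
    by rewrite [LHS]g0E [RHS]F1P h1P.
  rewrite [LHS]g1E -h2P [in LHS](tP (h2 x)) linear_sum.
  under eq_bigr do rewrite linearZ.
  rewrite F1_sum [RHS]linear_sum; apply: eq_bigr => l _.
  by rewrite [RHS]linearZ [in RHS]cplx_diff1_unit.
move=> x; rewrite [LHS](_ : _ = cplx_augm alpha m mA (g0 x)) // g0E /F0.
rewrite linearZ /=.
by rewrite cplx_augmE p1 incl_scale1 f0P h0P -Linf_cstE.
Qed.
End Embedding.

(** * The cost estimate *)

Section Final.
Context (R : realType) (d : measure_display) (X : measurableType d).
Context (mu : probability X R) (G : groupType).
Variable alpha : standard_action mu G.
Local Notation RR := (crossed (Linf_action alpha)).
Local Notation LL := (crossed_base (Linf_action alpha)).
Local Notation chiR := (chiR alpha).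
Local Notation grpR := (grpR alpha).
Local Notation one := (1 : Linf mu).

Section Span.
Variables (I : finType) (A : I -> set X) (V : I -> RR).
Definition family_span (r : RR) : Prop :=
  exists a : I -> RR, \sum_i a i * chiR (A i) * V i = r.

Lemma family_spanD r s : family_span r -> family_span s -> family_span (r + s).
Proof.
move=> [a <-] [b <-]; exists (fun i => a i + b i).
by rewrite -big_split; apply: eq_bigr => i _ /=; rewrite !mulrDl.
Qed.

Lemma family_span0 : family_span 0.
Proof. by exists (fun=> 0); rewrite big1 // => i _; rewrite !mul0r. Qed.

Lemma family_spanM c r : family_span r -> family_span (c * r).
Proof.
move=> [a <-]; exists (fun i => c * a i).
by rewrite mulr_sumr; apply: eq_bigr => i _; rewrite !mulrA.
Qed.

Lemma family_span_gen i : family_span (chiR (A i) * V i).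
Proof.
exists (fun j => (j == i)%:R); rewrite (bigD1 i) //= eqxx mul1r.
by rewrite big1 ?addr0 // => j /negPf ->; rewrite !mul0r.
Qed.

Lemma family_span_sum (J : Type) (s : seq J) (P : pred J) (F : J -> RR) :
  (forall j, P j -> family_span (F j)) -> family_span (\sum_(j <- s | P j) F j).
Proof.
by move=> FS; apply: big_ind => //; [exact: family_span0|exact: family_spanD].
Qed.
End Span.

(** The points that the forest of [U] misses are made into roots of their own:
    [p] is extended by the identity outside [U], and the edges of the forest
    stay loops. *)
Lemma forest_retraction_complete (E : nat -> set X) (gam : nat -> G)
    (A0 U : set X) (p : RR) (B : nat -> set X) : measurable U ->
  forest_retraction E gam A0 U p B ->
  exists q : RR, [/\ q *: (one : LL) = one,
    forall n, chiR (B n) * (grpR (gam n) - 1) * q = 0,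
    forall n, measurable (B n) /\ B n `<=` E n &
    exists N0, forall N, (N0 <= N)%N ->
      (\sum_(n < N) mu (B n) + (mu A0 + mu (~` U)) = 1)%E].
Proof.
move=> mU [Up p1 PB Bp [N0 sB]].
have mU' := measurableC mU.
have U'U : ~` U `&` U = set0 by rewrite setIC setICr.
exists (p + chiR (~` U)); split.
- by rewrite scalerDl p1 chiR_scale mulr1 chiU ?setUCr ?chi_setT // setICr.
- move=> n; have [mB _ BU BgU] := PB n.
  by rewrite mulrDr Bp add0r (chiR_diff_ortho mU' mB BU BgU U'U).
- by move=> n; have [mB BE _ _] := PB n.
- exists N0 => N /sB sBN; rewrite addeA sBN.
  rewrite -(probability_setT mu) -(setUCr U) measureU //.
  by rewrite setICr.
Qed.

Lemma medim_le_graphing (C : free_resolution G) (Phi : graphing alpha) (e : R) :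
  infinite_set [set: G] -> type_FP G 2 -> 0 < e ->
  (medim alpha 1 C + 1%:E <= graphing_cost Phi + e%:E)%E.
Proof.
move=> infG FP2 e0.
have [n [z [z0 build]]] := FP2_embedding alpha C FP2.
have [E [gam [mE costE edgesP]]] := graphing_edges Phi.
pose S := flatten [seq enum_fset (finsupp (z j)) | j <- enum 'I_n].
(* One share for [A0], one for the points missed by the forest, and one for each
   element of [S]. *)
pose e' := e / (size S).+2%:R; have e'0 : 0 < e' by rewrite divr_gt0.
have [A0 [mA0 A0e meetA0]] := small_section alpha infG e'0.
have [w we] := grow_large mE edgesP mA0 meetA0 e'0.
have [p0 [B forest]] := forest_retraction_grow alpha gam mE mA0 w.
have mU : measurable (grow alpha E gam A0 w) by exact: measurable_grow.
have [p [p1 Bp PB [N0 sB]]] := forest_retraction_complete mU forest.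
have /choice[k kP] :=
  fun i : 'I_(size S) => reach_large mE edgesP (nth 1%g S i) e'0.
pose T (i : 'I_(size S)) := reach alpha E gam (nth 1%g S i) (k i).
have mT i : measurable (T i) by exact: measurable_reach.
have /choice[M MP] : forall i : 'I_(size S), exists N,
    edge_span E gam N (chiR (T i) * (grpR (nth 1%g S i) - 1)).
  by move=> i; exact: reach_span.
pose N := maxn N0 (\max_i M i).
have NN0 : (N0 <= N)%N by rewrite leq_maxl.
have NM i : edge_span E gam N (chiR (T i) * (grpR (nth 1%g S i) - 1)).
  by apply: edge_span_le (MP i); rewrite /N leq_max leq_bigmax orbT.
pose I := ('I_N + 'I_(size S))%type.
(* An edge is kept where it is not used by the forest, and each [s] of [S] is
   added as an edge on the points outside [T], which the chosen paths do not
   join to their image. *)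
pose A (i : I) := match i with inl n => E n `\` B n | inr i => ~` T i end.
pose V (i : I) :=
  (grpR match i with inl n => gam n | inr i => nth 1%g S i end - 1) * p.
have mEB m : measurable (E m `\` B m).
  by apply: measurableD => //; have [] := PB m.
have mA i : measurable (A i).
  by case: i => i /=; [exact: mEB|exact: measurableC].
have V0 i : V i *: (one : LL) = 0.
  by rewrite -scalerA p1 scalerBl scale1r grpR_scale rmorph1 subrr.
have spanS g : g \in S -> family_span A V ((grpR g - 1) * p).
  move=> gS; have iS : (index g S < size S)%N by rewrite index_mem.
  pose i := Ordinal iS; have gi : nth 1%g S i = g by rewrite nth_index.
  have -> : (grpR g - 1) * p =
      chiR (T i) * (grpR g - 1) * p + chiR (~` T i) * ((grpR g - 1) * p).
    rewrite (mulrA (chiR (~` T i))) -mulrDl -mulrDl.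
    rewrite -chiRD ?setUCr ?setICr //; last exact: measurableC.
    by rewrite chiR_setT mul1r.
  apply: family_spanD; last first.
    by have := family_span_gen A V (inr i); rewrite /V /= gi.
  have [a] := NM i; rewrite gi => ->; rewrite mulr_suml.
  apply: family_span_sum => j _; rewrite -mulrA; apply: family_spanM.
  have [mB BE] := PB j.
  (* The forest part [B j] of the edge contributes nothing after [p]. *)
  have -> : E j = B j `|` (E j `\` B j) by rewrite setDUK.
  rewrite (chiRD alpha mB (mEB j)); last by rewrite setDE setICA setICr setI0.
  rewrite 2!mulrDl Bp add0r -mulrA.
  exact: (family_span_gen A V (inl j)).
have imz j : family_span A V (group_ring_incl (Linf_action alpha) (z j) * p).
  rewrite (incl_augm0 _ (z0 j)) mulr_suml big_seq.
  apply: family_span_sum => g gz; rewrite -mulrA.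
  apply: family_spanM; apply: spanS.
  apply/flattenP; exists (enum_fset (finsupp (z j))) => //.
  by apply/mapP; exists j => //; rewrite mem_enum.
have [D DE dimD] := build I A V p mA V0 p1 imz.
have medimD : (medim alpha 1 C <= \sum_i mu (A i))%E.
  by apply: ereal_inf_lbound; exists D.
apply: (@le_trans _ _ (\sum_i mu (A i) + 1%:E)%E); first exact: leeD2r.
have sumB := sB N NN0.
rewrite big_sumType /= -sumB.
have sumT : (\sum_(i < size S) mu (~` T i) <= ((size S)%:R * e')%:E)%E.
  apply: (@le_trans _ _ (\sum_(i < size S) e'%:E)%E).
    by apply: lee_sum => i _; exact: kP.
  by rewrite sumEFin sumr_const card_ord mulr_natl.
have sumE : (\sum_(i < N) mu (E i `\` B i) + \sum_(i < N) mu (B i) <=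
    graphing_cost Phi)%E.
  apply: le_trans (costE N); rewrite -big_split /=; apply: lee_sum => i _.
  have [mB BE] := PB i.
  rewrite -measureU //; first by rewrite setUC setDUK.
  by rewrite setDE -setIA setICl setI0.
rewrite addeACA; apply: leeD => //.
apply: (@le_trans _ _ (((size S)%:R * e')%:E + (e'%:E + e'%:E))%E).
  by apply: leeD => //; exact: leeD.
rewrite -!EFinD lee_fin.
have -> : (size S)%:R * e' + (e' + e') = (size S).+2%:R * e'.
  by rewrite -addn2 natrD mulrDl [2%:R * _]mulr_natl mulr2n.
by rewrite mulrC divfK.
Qed.

End Final.

Theorem theorem1p12 (G : groupType) (R : realType) (d : measure_display)
    (X : measurableType d) (mu : probability X R)
    (alpha : standard_action mu G) (C : free_resolution G)
    (G_infinite : infinite_set [set: G]) (G_FP2 : type_FP G 2) :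
  (medim alpha 1 C <= cost alpha - 1%:E)%E.
Proof.
rewrite leeBrDr //; apply/ereal_infP => _ [Phi _ <-].
by apply/lee_addgt0Pr => e e0; exact: medim_le_graphing.
Qed.
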